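(* For Lebesgue-almost every right triangle (right triangles being parametrized up to similarity by one acute angle in $(0,\pi/2)$, with Lebesgue measure), the following holds: for every $\epsilon>0$, the complexity function $P_n$ of the billiard in the triangle satisfies $$\limsup_{n\to\infty}\frac{P_n}{n^{\frac{2}{\sqrt{3}}-\epsilon}}>0 .$$
   Context: Billiard in a polygon: a point moves along straight lines inside the polygon and reflects from the sides by the usual law (angle of incidence equals angle of reflection); an orbit stops when it hits a vertex. A generalized diagonal of a polygonal billiard is a billiard orbit segment that starts at a vertex of the polygon, ends at a vertex of the polygon, and does not hit a vertex in between. Its (algebraic) length is the number of reflections from the sides. The complexity function $P_n$ is the number of generalized diagonals of length no greater than $n$. ''Typical'' in the paper means for almost every polygon of the class in the sense of Lebesgue measure on the angle parameter. *)

(* Defs.v *)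
From HB Require Import structures.
From mathcomp Require Export all_boot all_order all_algebra.
From mathcomp Require Export all_classical all_reals all_analysis.
Export Order.TTheory GRing.Theory Num.Theory.
Export numFieldNormedType.Exports.

Set Implicit Arguments.
Unset Strict Implicit.
Unset Printing Implicit Defensive.

Local Open Scope classical_set_scope.
Local Open Scope ring_scope.

Definition dot (R : realType) (u v : 'rV[R]_2) : R := \sum_i u 0 i * v 0 i.

(* Mirror image of the vector w in the line spanned by e (for e != 0). *)
Definition mirror (R : realType) (e w : 'rV[R]_2) : 'rV[R]_2 :=
  (2 * dot w e / dot e e) *: e - w.

Definition open_segment (R : realType) (p q : 'rV[R]_2) : set 'rV[R]_2 :=
  [set (1 - t) *: p + t *: q | t in [set t : R | 0 < t < 1]].

(* A triangle is the 3-tuple of its vertices; side j joins vertex j to the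
   cyclically next vertex. *)
Definition side_dir (R : realType) (T : 3.-tuple 'rV[R]_2) (j : 'I_3)
    : 'rV[R]_2 :=
  tnth T (ordS j) - tnth T j.

(* The endpoints are excluded: an orbit stops when it hits a vertex. *)
Definition side (R : realType) (T : 3.-tuple 'rV[R]_2) (j : 'I_3)
    : set 'rV[R]_2 :=
  open_segment (tnth T j) (tnth T (ordS j)).

(* Points with positive barycentric coordinates. *)
Definition triangle_interior (R : realType) (T : 3.-tuple 'rV[R]_2)
    : set 'rV[R]_2 :=
  [set \sum_(j < 3) w j *: tnth T j | w in
     [set w : 'I_3 -> R | (forall j, 0 < w j) /\ \sum_(j < 3) w j = 1]].

(* Coming from p, the orbit is reflected at x from side j and goes on to q:
   the outgoing velocity has the direction of the mirror image of the incoming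
   one, i.e. the angle of reflection equals the angle of incidence. *)
Definition reflected_at (R : realType) (T : 3.-tuple 'rV[R]_2) (j : 'I_3)
    (p x q : 'rV[R]_2) : Prop :=
  side T j x /\
  exists2 c : R, 0 < c & q - x = c *: mirror (side_dir T j) (x - p).

(* A generalized diagonal is encoded by the sequence s of its successive
   boundary points: the initial vertex, the reflection points, the final
   vertex. Orbits are oriented. *)
Definition generalized_diagonal (R : realType) (T : 3.-tuple 'rV[R]_2)
    (s : seq 'rV[R]_2) : Prop :=
  [/\ (2 <= size s)%N,
      head 0 s \in T,
      last 0 s \in T,
      forall i : nat, (i.+1 < size s)%N ->
        open_segment s`_i s`_i.+1 `<=` triangle_interior T
    & forall i : nat, (i.+2 < size s)%N ->
        exists j : 'I_3, reflected_at T j s`_i s`_i.+1 s`_i.+2].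

(* Number of reflections: the two end vertices do not count. *)
Definition diagonal_length (R : realType) (s : seq 'rV[R]_2) : nat :=
  (size s - 2)%N.

Definition complexity (R : realType) (T : 3.-tuple 'rV[R]_2) (n : nat)
    : \bar R :=
  counting [set s : seq 'rV[R]_2 |
    generalized_diagonal T s /\ (diagonal_length s <= n)%N].

Definition point (R : realType) (x y : R) : 'rV[R]_2 :=
  \row_(i < 2) if i == 0 then x else y.

(* Hypotenuse of length 1, angle alpha at the origin, right angle at the
   second vertex. *)
Definition right_triangle (R : realType) (alpha : R) : 3.-tuple 'rV[R]_2 :=
  [tuple point 0 0; point (cos alpha) 0; point (cos alpha) (sin alpha)].

(* Main.v *)
Require Import Defs.
From mathcomp Require Import ring lra zify.

(* The ray issued from the vertex of angle alpha (apex) in the direction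
   (cos alpha, y) is unfolded into a straight line crossing reflected copies of
   the triangle; its itinerary is the word of the sides (left or right) on which
   it leaves the far vertices. The values of y whose ray hits a vertex within n
   reflections cut (0, sin alpha) into intervals ("leaves"), one for each word
   of length n, so it suffices to bound the number Z_n of leaves from below.
   A leaf of length d is the base of a strip free of vertices, of width about
   d n at distance about n. The unfolded hypotenuses have directions
   (2k + 1) alpha, k changing by one at each crossing, and a strip of width w
   cannot cross a hypotenuse making with it an angle smaller than w. If p/q is
   a Dirichlet approximation of 2 alpha / pi, every block of q consecutive
   values of k contains such a barrier for w = 4/q, so that k is confined to 2q
   values; by the pigeonhole principle the strip overlaps a translate of itself
   after O(q^2) crossings, and its word is periodic from then on. Hence a leaf
   of length at least 4/q^3 is determined by its prefix of length O(q^2), while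
   its length is O(1/n). Therefore Z_n >= const q^3 or Z_{O(q^2)} >= const n;
   with n = q^(5/2), both alternatives give the exponent 6/5 > 2/sqrt 3. *)

Set Implicit Arguments.
Unset Strict Implicit.
Unset Printing Implicit Defensive.

Local Open Scope classical_set_scope.
Local Open Scope ring_scope.

(** * Unfolded triangles *)

(** Labels are plain numbers, so that a case analysis on the six orderings turns every
    label-dependent formula into a concrete polynomial one. *)
Inductive perm3 : nat -> nat -> nat -> Prop :=
| Perm012 : perm3 0 1 2 | Perm021 : perm3 0 2 1 | Perm102 : perm3 1 0 2
| Perm120 : perm3 1 2 0 | Perm201 : perm3 2 0 1 | Perm210 : perm3 2 1 0.

Lemma perm3_swap12 i j k : perm3 i j k -> perm3 j i k.
Proof. by case; constructor. Qed.

Lemma perm3_swap13 i j k : perm3 i j k -> perm3 k j i.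
Proof. by case; constructor. Qed.

Lemma perm3_swap23 i j k : perm3 i j k -> perm3 i k j.
Proof. by case; constructor. Qed.

Definition sg {R : realType} (b : bool) : R := if b then 1 else -1.

Lemma sg_sqr {R : realType} b : sg b * sg b = 1 :> R.
Proof. by case: b; rewrite /sg; ring. Qed.

Lemma sgN {R : realType} b : sg (~~ b) = - sg b :> R.
Proof. by case: b; rewrite /sg; ring. Qed.

(* A copy of the triangle: the image of the original one under the isometry
   z |-> (apx, apy) +/- e^(2 i lev alpha) z, the sign being given by eps, with z
   replaced by its complex conjugate when sig is false. *)
Record frame (R : realType) :=
  Frame { apx : R; apy : R; lev : int; eps : bool; sig : bool }.

(* A triangle just entered by the ray: labels of the end points of the side
   crossed, left and right of the ray, and of the opposite vertex. *)
Record state (R : realType) :=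
  State { fr : frame R; lft : nat; rgt : nat; far : nat }.

Section Unfolding.
Variables (R : realType) (alpha : R).
Hypothesis alphaP : 0 < alpha < pi / 2.

Local Notation c := (cos alpha).
Local Notation h := (sin alpha).

Lemma c_gt0 : 0 < c.
Proof. by case/andP: alphaP => ? ?; apply: cos_gt0_pihalf; apply/andP; split; lra. Qed.

Lemma h_gt0 : 0 < h.
Proof.
by case/andP: alphaP => ? ?; apply: sin_gt0_pi; apply/andP; split; have := pi_gt0 R; lra.
Qed.

Lemma ch1 : c * c + h * h = 1.
Proof. by rewrite -!expr2 cos2Dsin2. Qed.

Definition rotc (k : int) : R := cos (k%:~R * (2 * alpha)).
Definition rots (k : int) : R := sin (k%:~R * (2 * alpha)).

Lemma hh : h * h = 1 - c * c.
Proof. by rewrite -ch1; ring. Qed.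

Lemma rot1 k : rotc k * rotc k + rots k * rots k = 1.
Proof. by rewrite -!expr2 cos2Dsin2. Qed.

Lemma cos2a : cos (2 * alpha) = c * c - h * h.
Proof. by rewrite (_ : 2 * alpha = alpha + alpha) ?cosD; ring. Qed.

Lemma sin2a : sin (2 * alpha) = 2 * c * h.
Proof. by rewrite (_ : 2 * alpha = alpha + alpha) ?sinD; ring. Qed.

Definition levstep (b : bool) : int := if b then 1 else -1.
Arguments levstep : simpl never.

Lemma rotc_step k b :
  rotc (k + levstep b) = rotc k * (c * c - h * h) - sg b * rots k * (2 * c * h).
Proof.
rewrite /rotc /rots intrD mulrDl; case: b; rewrite /levstep /=.
  by rewrite mul1r cosD cos2a sin2a; ring.
by rewrite mulN1r cosD cosN sinN cos2a sin2a; ring.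
Qed.

Lemma rots_step k b :
  rots (k + levstep b) = rots k * (c * c - h * h) + sg b * rotc k * (2 * c * h).
Proof.
rewrite /rotc /rots intrD mulrDl; case: b; rewrite /levstep /=.
  by rewrite mul1r sinD cos2a sin2a; ring.
by rewrite mulN1r sinD cosN sinN cos2a sin2a; ring.
Qed.

Definition vtx (f : frame R) (j : nat) : R * R :=
  let C := rotc (lev f) in let S := rots (lev f) in
  match j with
  | 0 => (apx f, apy f)
  | 1 => (apx f + sg (eps f) * (c * C), apy f + sg (eps f) * (c * S))
  | _ => (apx f + sg (eps f) * (c * C - sg (sig f) * (h * S)),
          apy f + sg (eps f) * (c * S + sg (sig f) * (h * C)))
  end.

(** Mirror image of a copy in the side opposite to vertex [j]. Crossing a leg keeps the rotation
    level; only the hypotenuse ([j] = 1) changes it, by one. *)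
Definition refl (j : nat) (f : frame R) : frame R :=
  match j with
  | 0 => Frame (apx f + 2 * sg (eps f) * (c * rotc (lev f)))
           (apy f + 2 * sg (eps f) * (c * rots (lev f)))
           (lev f) (~~ eps f) (~~ sig f)
  | 1 => Frame (apx f) (apy f) (lev f + levstep (sig f)) (eps f) (~~ sig f)
  | _ => Frame (apx f) (apy f) (lev f) (eps f) (~~ sig f)
  end.

Lemma vtx_refl f i k j : perm3 i k j -> vtx (refl j f) i = vtx f i.
Proof.
have H := hh.
by case; case: f => x y k' [] [] /=; rewrite /vtx /= ?rotc_step ?rots_step /sg;
   congr pair; ring: H.
Qed.

(** Weight of the third vertex [k] in the foot of the altitude from [j], written as a barycentre of
    [i] and [k]; the mirror image of [j] is twice the foot minus [j]. *)
Definition refcoef (j i : nat) : R :=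
  match j, i with
  | 1, 0 => c ^+ 2 | 2, 0 => 1 | _, 1 => 0 | 0, _ => 1 | _, _ => h ^+ 2
  end.

Lemma vtx_refl_self f i k j : perm3 i k j ->
  (vtx (refl j f) j).1 = 2 * refcoef j i * (vtx f k).1
     + 2 * (1 - refcoef j i) * (vtx f i).1 - (vtx f j).1 /\
  (vtx (refl j f) j).2 = 2 * refcoef j i * (vtx f k).2
     + 2 * (1 - refcoef j i) * (vtx f i).2 - (vtx f j).2.
Proof.
have H := hh.
by case; case: f => x y k' [] [] /=; rewrite /vtx /= ?rotc_step ?rots_step /sg;
   split; ring: H.
Qed.

Definition dist2 (A B : R * R) : R := (A.1 - B.1) ^+ 2 + (A.2 - B.2) ^+ 2.

Definition len2 (i j : nat) : R :=
  match i, j with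
  | 0, 1 | 1, 0 => c ^+ 2 | 1, _ | _, 1 => h ^+ 2 | _, _ => 1
  end.

Lemma vtx_dist2 f i j k : perm3 i j k -> dist2 (vtx f i) (vtx f j) = len2 i j.
Proof.
have r1 := rot1 (lev f).
have e01 : dist2 (vtx f 0) (vtx f 1) = c ^+ 2.
  transitivity ((sg (eps f) * sg (eps f)) * (c ^+ 2 *
    (rotc (lev f) * rotc (lev f) + rots (lev f) * rots (lev f)))).
    by rewrite /dist2 /vtx /=; ring.
  by rewrite sg_sqr r1 mul1r mulr1.
have e02 : dist2 (vtx f 0) (vtx f 2) = 1.
  transitivity ((sg (eps f) * sg (eps f)) *
    ((c * c + (sg (sig f) * sg (sig f)) * (h * h)) *
    (rotc (lev f) * rotc (lev f) + rots (lev f) * rots (lev f)))).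
    by rewrite /dist2 /vtx /=; ring.
  by rewrite !sg_sqr r1 !mul1r mulr1 ch1.
have e12 : dist2 (vtx f 1) (vtx f 2) = h ^+ 2.
  transitivity ((sg (eps f) * sg (eps f)) * (sg (sig f) * sg (sig f)) * (h ^+ 2 *
    (rotc (lev f) * rotc (lev f) + rots (lev f) * rots (lev f)))).
    by rewrite /dist2 /vtx /=; ring.
  by rewrite !sg_sqr r1 !mul1r mulr1.
have sym A B : dist2 A B = dist2 B A by rewrite /dist2; ring.
by case; rewrite ?(sym (vtx f 2)) ?(sym (vtx f 1) (vtx f 0)) ?e01 ?e02 ?e12.
Qed.

Lemma len2_bounds i j k : perm3 i j k -> (c * h) ^+ 2 <= len2 i j <= 1.
Proof.
have H := hh; have c0 := c_gt0; have h0 := h_gt0.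
have c1 : c ^+ 2 <= 1 by nra.
have h1 : h ^+ 2 <= 1 by nra.
have chc : (c * h) ^+ 2 <= c ^+ 2 by rewrite exprMn; nra.
have chh : (c * h) ^+ 2 <= h ^+ 2 by rewrite exprMn; nra.
have ch1' := le_trans chc c1.
by case; apply/andP; split.
Qed.

Lemma vtx_dist2_bounds f i j k : perm3 i j k ->
  (c * h) ^+ 2 <= dist2 (vtx f i) (vtx f j) <= 1.
Proof. by move=> p; rewrite (vtx_dist2 f p); apply: len2_bounds p. Qed.

Lemma refcoef_bounds i k j : perm3 i k j -> 0 <= refcoef j i <= 1.
Proof.
have H := ch1.
by case=> /=; apply/andP; split; have := sqr_ge0 c; have := sqr_ge0 h; nra.
Qed.

(** The product is the squared cosine of the angle at [i], namely [c ^+ 2], 0 or [h ^+ 2], which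
    stays away from 1. *)
Lemma refcoef_mul_le i k j : perm3 i k j ->
  refcoef j i * refcoef k i <= 1 - (c * h) ^+ 2.
Proof.
move=> p; have := cos2Dsin2 alpha; have := sqr_ge0 c; have := sqr_ge0 h.
rewrite exprMn; case: p => /=; move: (c ^+ 2) (h ^+ 2) => a b b0 a0 ab;
  have -> : a = 1 - b by lra.
all: by have := sqr_ge0 b; have := sqr_ge0 (1 - b); nra.
Qed.

Definition dot3 (A B C : R * R) : R :=
  (B.1 - A.1) * (C.1 - A.1) + (B.2 - A.2) * (C.2 - A.2).

Lemma refcoef_dot f i k j : perm3 i k j ->
  dot3 (vtx f i) (vtx f k) (vtx f j) =
  refcoef j i * dist2 (vtx f i) (vtx f k).
Proof.
move=> p; have H := ch1.
have -> A B C : dot3 A B C = (dist2 A B + dist2 A C - dist2 B C) / 2.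
  by rewrite /dot3 /dist2; field.
rewrite (vtx_dist2 f p) (vtx_dist2 f (perm3_swap23 p)).
rewrite (vtx_dist2 f (perm3_swap12 (perm3_swap13 p))).
by case: p => /=; lra.
Qed.

Definition cross3 (A B C : R * R) : R :=
  (B.1 - A.1) * (C.2 - A.2) - (B.2 - A.2) * (C.1 - A.1).

Definition Lp (s : state R) := vtx (fr s) (lft s).
Definition Rp (s : state R) := vtx (fr s) (rgt s).
Definition Wp (s : state R) := vtx (fr s) (far s).

(* The turn is true when the far vertex is on the left of the ray. *)
Definition step (s : state R) (a : bool) : state R :=
  if a then State (refl (lft s) (fr s)) (far s) (rgt s) (lft s)
  else State (refl (rgt s) (fr s)) (lft s) (far s) (rgt s).

Arguments step : simpl never.

(** Invariant of the states: left, right and far vertex follow each other counterclockwise, and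
    [c * h] is twice the area. *)
Definition geo (s : state R) : Prop :=
  perm3 (lft s) (rgt s) (far s) /\ cross3 (Lp s) (Rp s) (Wp s) = c * h.

(** The ray has just left the original triangle through the leg opposite to the apex, with vertex 2
    on its left and vertex 1 on its right. *)
Definition st0 : state R := State (refl 0 (Frame 0 0 0 true true)) 2 1 0.

Lemma rotc0 : rotc 0 = 1. Proof. by rewrite /rotc mul0r cos0. Qed.
Lemma rots0 : rots 0 = 0. Proof. by rewrite /rots mul0r sin0. Qed.

Lemma geo0 : geo st0.
Proof.
split; first by constructor.
by rewrite /cross3 /Lp /Rp /Wp /= /sg rotc0 rots0; ring.
Qed.

Definition fcoef (s : state R) (a : bool) : R :=
  if a then refcoef (lft s) (rgt s) else refcoef (rgt s) (lft s).

Arguments fcoef : simpl never.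

Lemma step_true s (A := fcoef s true) : geo s ->
  [/\ Lp (step s true) = Wp s, Rp (step s true) = Rp s &
   [/\ 0 <= A <= 1, dot3 (Rp s) (Wp s) (Lp s) = A * dist2 (Rp s) (Wp s) &
    Wp (step s true) =
     (2 * A * (Wp s).1 + 2 * (1 - A) * (Rp s).1 - (Lp s).1,
      2 * A * (Wp s).2 + 2 * (1 - A) * (Rp s).2 - (Lp s).2)]].
Proof.
case=> p _; rewrite /Lp /Rp /Wp /=; split.
- by apply: (@vtx_refl _ _ (rgt s)); case: p; constructor.
- by apply: (@vtx_refl _ _ (far s)); case: p; constructor.
have p' := perm3_swap23 (perm3_swap12 p).
split; [exact: refcoef_bounds p' | exact: refcoef_dot p' |].
rewrite [vtx _ _]surjective_pairing.
by have [-> ->] := vtx_refl_self (fr s) p'.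
Qed.

Lemma step_false s (A := fcoef s false) : geo s ->
  [/\ Lp (step s false) = Lp s, Rp (step s false) = Wp s &
   [/\ 0 <= A <= 1, dot3 (Lp s) (Wp s) (Rp s) = A * dist2 (Lp s) (Wp s) &
    Wp (step s false) =
     (2 * A * (Wp s).1 + 2 * (1 - A) * (Lp s).1 - (Rp s).1,
      2 * A * (Wp s).2 + 2 * (1 - A) * (Lp s).2 - (Rp s).2)]].
Proof.
case=> p _; rewrite /Lp /Rp /Wp /=; split.
- by apply: (@vtx_refl _ _ (far s)); case: p; constructor.
- by apply: (@vtx_refl _ _ (lft s)); case: p; constructor.
have p' := perm3_swap23 p.
split; [exact: refcoef_bounds p' | exact: refcoef_dot p' |].
rewrite [vtx _ _]surjective_pairing.
by have [-> ->] := vtx_refl_self (fr s) p'.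
Qed.

Lemma geo_step s a : geo s -> geo (step s a).
Proof.
move=> g; have [p o] := g; split.
  by case: a; [apply: perm3_swap13 | apply: perm3_swap23].
rewrite -o; case: a.
  by have [-> -> [_ _ ->]] := step_true g; rewrite /cross3 /=; ring.
by have [-> -> [_ _ ->]] := step_false g; rewrite /cross3 /=; ring.
Qed.

Lemma geo_run s b : geo s -> geo (foldl step s b).
Proof. by elim: b s => //= a b IH s g; apply/IH/geo_step. Qed.

(** * Rays from the apex and their crossing times *)

Definition cr (y : R) (Z : R * R) : R := c * Z.2 - y * Z.1.

Definition det2 (A B : R * R) : R := A.1 * B.2 - A.2 * B.1.

(** The sign of [cr y Z] tells on which side of the line of direction [(c, y)] the point [Z] lies;
    positivity of [det2] says that the side is met by the ray itself and not by its backward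
    continuation. *)
Definition ray (s : state R) (y : R) : Prop :=
  [/\ 0 < cr y (Lp s), cr y (Rp s) < 0 & 0 < det2 (Rp s) (Lp s)].

Definition tau (s : state R) (y : R) : R :=
  det2 (Rp s) (Lp s) / (cr y (Lp s) - cr y (Rp s)).

Definition turn (s : state R) (y : R) (a : bool) : bool :=
  if a then 0 < cr y (Wp s) else cr y (Wp s) < 0.

Lemma ray0 y : 0 < y < h -> ray st0 y.
Proof.
case/andP=> y0 yh; have c0 := c_gt0; have h0 := h_gt0.
by split; rewrite /cr /det2 /Lp /Rp /= /sg rotc0 rots0; nra.
Qed.

(** The determinant identity [E] makes the crossing time grow by a positive multiple of twice the
    area [c * h]; this also keeps the crossing in front of the apex. *)
Lemma ray_step s y a : geo s -> ray s y -> turn s y a ->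
  ray (step s a) y /\ tau s y < tau (step s a) y.
Proof.
move=> g [l0 r0 d0] t; have ch0 : 0 < c * h by rewrite mulr_gt0 ?c_gt0 ?h_gt0.
have [_ o] := g; case: a t => /= w0.
  have [eL eR _] := step_true g.
  have D0 : 0 < cr y (Lp s) - cr y (Rp s) by lra.
  have D0' : 0 < cr y (Wp s) - cr y (Rp s) by lra.
  have E : det2 (Rp s) (Wp s) * (cr y (Lp s) - cr y (Rp s)) =
    det2 (Rp s) (Lp s) * (cr y (Wp s) - cr y (Rp s)) - cr y (Rp s) * (c * h).
    by rewrite -o /det2 /cr /cross3; ring.
  have P : 0 < - (cr y (Rp s) * (c * h)) by rewrite -mulNr mulr_gt0 ?oppr_gt0.
  have Q := mulr_gt0 d0 D0'.
  split.
    split; rewrite ?eL ?eR //.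
    by rewrite -(pmulr_lgt0 _ D0) E; lra.
  rewrite /tau eL eR ltr_pdivrMr // mulrAC ltr_pdivlMr // E; lra.
have [eL eR _] := step_false g.
have D0 : 0 < cr y (Lp s) - cr y (Rp s) by lra.
have D0' : 0 < cr y (Lp s) - cr y (Wp s) by lra.
have E : det2 (Wp s) (Lp s) * (cr y (Lp s) - cr y (Rp s)) =
  det2 (Rp s) (Lp s) * (cr y (Lp s) - cr y (Wp s)) + cr y (Lp s) * (c * h).
  by rewrite -o /det2 /cr /cross3; ring.
have P : 0 < cr y (Lp s) * (c * h) by rewrite mulr_gt0.
have Q := mulr_gt0 d0 D0'.
split.
  split; rewrite ?eL ?eR //.
  by rewrite -(pmulr_lgt0 _ D0) E; lra.
rewrite /tau eL eR ltr_pdivrMr // mulrAC ltr_pdivlMr // E; lra.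
Qed.

Lemma tau_gt0 s y : ray s y -> 0 < tau s y.
Proof. by case=> l0 r0 d0; rewrite divr_gt0 // subr_gt0 (lt_trans r0). Qed.

Fixpoint valid (s : state R) (y : R) (b : seq bool) : Prop :=
  if b is a :: b' then turn s y a /\ valid (step s a) y b' else True.

Lemma valid_cat s y b b' :
  valid s y (b ++ b') <-> valid s y b /\ valid (foldl step s b) y b'.
Proof.
elim: b s => [|a b IH] s /=; first by tauto.
by rewrite IH; tauto.
Qed.

Lemma ray_run s y b : geo s -> ray s y -> valid s y b ->
  ray (foldl step s b) y.
Proof.
elim: b s => //= a b IH s g r [t v].
by have [r' _] := ray_step g r t; apply: IH => //; apply: geo_step.
Qed.

Lemma tau_run s y b : geo s -> ray s y -> valid s y b ->
  tau s y <= tau (foldl step s b) y.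
Proof.
elim: b s => //= a b IH s g r [t v].
have [r' lt] := ray_step g r t.
by apply: (le_trans (ltW lt)); apply: IH => //; apply: geo_step.
Qed.

(** Lagrange's identity, the direction [(c, y)] having norm at most 1 because [0 < y < h]. *)
Lemma cr_le1 y A B : 0 < y < h -> dist2 A B <= 1 -> `|cr y A - cr y B| <= 1.
Proof.
case/andP=> y0 yh d1; have h0 := h_gt0; have H := ch1.
rewrite -(@ler_pXn2r _ 2) ?nnegrE // expr1n real_normK ?num_real //.
have -> : (cr y A - cr y B) ^+ 2 = (c * c + y * y) * dist2 A B
   - (c * (A.1 - B.1) + y * (A.2 - B.2)) ^+ 2 by rewrite /cr /dist2; ring.
have : 0 <= dist2 A B by rewrite addr_ge0 // sqr_ge0.
have := sqr_ge0 (c * (A.1 - B.1) + y * (A.2 - B.2)).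
have : c * c + y * y <= 1 by nra.
have : 0 <= c * c + y * y by nra.
move: (dist2 A B) d1 (_ ^+ 2) (c * c + _) => d d1 e f; nra.
Qed.

Lemma side_le1 s : geo s -> dist2 (Lp s) (Rp s) <= 1.
Proof. by case=> p _; have /andP[] := vtx_dist2_bounds (fr s) p. Qed.

Lemma abs_le1_of_sqr (x z : R) : x ^+ 2 + z ^+ 2 <= 1 -> `|x| <= 1.
Proof.
move=> H; rewrite -(@ler_pXn2r _ 2) ?nnegrE // expr1n real_normK ?num_real //.
by have := sqr_ge0 z; lra.
Qed.

(** The first coordinate [c * tau] of the crossing point is a mean of those of the two ends, which
    differ by at most the length of the side, hence by at most 1. *)
Lemma tau_le_L s y : geo s -> ray s y -> c * tau s y - 1 <= (Lp s).1.
Proof.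
move=> g [l0 r0 _].
have D0 : 0 < cr y (Lp s) - cr y (Rp s) by lra.
have := abs_le1_of_sqr (side_le1 g); rewrite ler_norml => /andP[b1 b2].
rewrite lerBlDr /tau mulrA ler_pdivrMr //.
have -> : c * det2 (Rp s) (Lp s) = - cr y (Rp s) * (Lp s).1 + cr y (Lp s) * (Rp s).1.
  by rewrite /det2 /cr; ring.
by nra.
Qed.

Lemma tau_le_R s y : geo s -> ray s y -> c * tau s y - 1 <= (Rp s).1.
Proof.
move=> g [l0 r0 _].
have D0 : 0 < cr y (Lp s) - cr y (Rp s) by lra.
have := abs_le1_of_sqr (side_le1 g); rewrite ler_norml => /andP[b1 b2].
rewrite lerBlDr /tau mulrA ler_pdivrMr //.
have -> : c * det2 (Rp s) (Lp s) = - cr y (Rp s) * (Lp s).1 + cr y (Lp s) * (Rp s).1.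
  by rewrite /det2 /cr; ring.
by nra.
Qed.

End Unfolding.

Arguments step : simpl never.
Arguments fcoef : simpl never.

(** * Linear growth of the distance to the apex *)

Section Growth.
Variables (R : realType) (alpha : R).
Hypothesis alphaP : 0 < alpha < pi / 2.

Local Notation c := (cos alpha).
Local Notation h := (sin alpha).

(* Pivoting around two distinct vertices in succession, the ray goes from one
   side of a kite with diagonal e to the opposite side; here T (u1, u2) is the
   vector from V + s f to V + e + r (2 A e - f - e). *)
Lemma kite_crossing (e1 e2 f1 f2 u1 u2 A r s T S : R) :
  T * u1 = e1 + r * (2 * A * e1 - f1 - e1) - s * f1 ->
  T * u2 = e2 + r * (2 * A * e2 - f2 - e2) - s * f2 ->
  0 <= A <= 1 -> 0 <= r <= 1 -> 0 <= s <= 1 -> 0 <= T ->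
  `|e1 * u2 - e2 * u1| <= 1 -> e1 * u1 + e2 * u2 <= 1 ->
  `|e1 * f2 - e2 * f1| = S ->
  e1 * f1 + e2 * f2 = A * (e1 ^+ 2 + e2 ^+ 2) ->
  S / 2 <= T \/ (e1 ^+ 2 + e2 ^+ 2) / 2 <= T.
Proof.
move=> E1 E2 A01 r01 s01 T0 cr1 dt1 eS eA.
have /andP[A0 A1] := A01; have /andP[r0 r1] := r01; have /andP[s0 s1] := s01.
(* The cross product with [e] measures the heights of the entry and exit points on the two sides of
   the diagonal. *)
have H1 : (r + s) * S <= T.
  rewrite -eS -[r + s]ger0_norm ?addr_ge0 // -normrM.
  have -> : (r + s) * (e1 * f2 - e2 * f1) = - (T * (e1 * u2 - e2 * u1)).
    have -> : T * (e1 * u2 - e2 * u1) = e1 * (T * u2) - e2 * (T * u1) by ring.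
    by rewrite E1 E2; ring.
  by rewrite normrN normrM (ger0_norm T0) ler_piMr.
(* The scalar product with [e] measures the progress along the diagonal. *)
have H2 : (e1 ^+ 2 + e2 ^+ 2) * (1 - r - s) <= T.
  have -> : (e1 ^+ 2 + e2 ^+ 2) * (1 - r - s) =
     T * (e1 * u1 + e2 * u2) - (r * A + s * (1 - A)) * (e1 ^+ 2 + e2 ^+ 2).
    have -> : T * (e1 * u1 + e2 * u2) = e1 * (T * u1) + e2 * (T * u2) by ring.
    have X : e2 * f2 = A * (e1 ^+ 2 + e2 ^+ 2) - e1 * f1 by lra.
    by rewrite E1 E2; ring: X.
  have : T * (e1 * u1 + e2 * u2) <= T by rewrite ler_piMr.
  have : 0 <= (r * A + s * (1 - A)) * (e1 ^+ 2 + e2 ^+ 2).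
    apply: mulr_ge0; first by apply: addr_ge0; apply: mulr_ge0; lra.
    by apply: addr_ge0; apply: sqr_ge0.
  by lra.
have S0 : 0 <= S by rewrite -eS.
have Q0 : 0 <= e1 ^+ 2 + e2 ^+ 2 by rewrite addr_ge0 ?sqr_ge0.
have [rs|rs] := leP (r + s) (1 / 2).
  by right; apply: le_trans H2; rewrite ler_wpM2l //; lra.
by left; apply: le_trans H1; rewrite mulrC ler_wpM2r //; lra.
Qed.

Lemma tau_coord (s : state R) y : ray alpha s y ->
  exists2 t, 0 < t < 1 &
    tau alpha s y * c =
      (Rp alpha s).1 + t * ((Lp alpha s).1 - (Rp alpha s).1) /\
    tau alpha s y * y =
      (Rp alpha s).2 + t * ((Lp alpha s).2 - (Rp alpha s).2).
Proof.
move=> [l0 r0 _].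
have D0 : 0 < cr alpha y (Lp alpha s) - cr alpha y (Rp alpha s) by lra.
have D1 := lt0r_neq0 D0.
exists (- cr alpha y (Rp alpha s) /
         (cr alpha y (Lp alpha s) - cr alpha y (Rp alpha s))).
  by rewrite divr_gt0 ?ltr_pdivrMr ?oppr_gt0 //=; lra.
by split; rewrite /tau /det2 /cr in D1 *; field.
Qed.

Lemma dist2C (A B : R * R) : dist2 A B = dist2 B A.
Proof. by rewrite /dist2; ring. Qed.

Lemma dt_le1 y A B : 0 < y < h -> dist2 A B <= 1 ->
  (A.1 - B.1) * c + (A.2 - B.2) * y <= 1.
Proof.
case/andP=> y0 yh d1; have h0 := h_gt0 alphaP; have H := ch1 alpha.
suff : `|(A.1 - B.1) * c + (A.2 - B.2) * y| <= 1 by apply: le_trans (ler_norm _).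
rewrite -(@ler_pXn2r _ 2) ?nnegrE // expr1n real_normK ?num_real //.
have -> : ((A.1 - B.1) * c + (A.2 - B.2) * y) ^+ 2 =
   (c * c + y * y) * dist2 A B - (c * (A.2 - B.2) - y * (A.1 - B.1)) ^+ 2.
  by rewrite /dist2; ring.
have : 0 <= dist2 A B by rewrite addr_ge0 // sqr_ge0.
have := sqr_ge0 (c * (A.2 - B.2) - y * (A.1 - B.1)).
have : c * c + y * y <= 1 by nra.
have : 0 <= c * c + y * y by nra.
move: (dist2 A B) d1 (_ ^+ 2) (c * c + _) => d d1 e f; nra.
Qed.

Lemma kite_points (V O W : R * R) y A r s T : 0 < y < h ->
  (c * h) ^+ 2 <= dist2 V W <= 1 -> dot3 V W O = A * dist2 V W ->
  `|cross3 V W O| = c * h ->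
  0 <= A <= 1 -> 0 <= r <= 1 -> 0 <= s <= 1 -> 0 <= T ->
  T * c = W.1 + r * (2 * A * W.1 + 2 * (1 - A) * V.1 - O.1 - W.1)
          - (V.1 + s * (O.1 - V.1)) ->
  T * y = W.2 + r * (2 * A * W.2 + 2 * (1 - A) * V.2 - O.2 - W.2)
          - (V.2 + s * (O.2 - V.2)) ->
  (c * h) ^+ 2 / 2 <= T.
Proof.
move=> y0h /andP[d0 d1] dA cO A01 r01 s01 T0 E1 E2.
have ch2 : (c * h) ^+ 2 <= c * h.
  have c0 := c_gt0 alphaP; have h0 := h_gt0 alphaP.
  rewrite expr2 ler_piMr ?mulr_ge0 ?ltW //; have := ch1 alpha; nra.
have [] := @kite_crossing (W.1 - V.1) (W.2 - V.2) (O.1 - V.1) (O.2 - V.2)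
    c y A r s T (c * h) _ _ A01 r01 s01 T0.
- by rewrite E1; ring.
- by rewrite E2; ring.
- have -> : (W.1 - V.1) * y - (W.2 - V.2) * c = cr alpha y V - cr alpha y W.
    by rewrite /cr; ring.
  have X := cr_le1 alphaP y0h d1. exact: X.
- by rewrite dist2C in d1; exact: dt_le1 y0h d1.
- exact: cO.
- by rewrite -[LHS]/(dot3 V W O) dA /dist2; ring.
- by lra.
- by move: d0; rewrite /dist2; lra.
Qed.

(** The triangle and its mirror image form a kite whose diagonal joins the two successive pivots:
    [Rp s] and [Wp s] when [a] is true, [Lp s] and [Wp s] otherwise. *)
Lemma tau_zigzag (s : state R) y a : 0 < y < h -> geo alpha s ->
  ray alpha s y -> valid alpha s y [:: a; ~~ a] ->
  tau alpha s y + (c * h) ^+ 2 / 2 <=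
  tau alpha (step alpha (step alpha s a) (~~ a)) y.
Proof.
move=> y0h g r [v1 [v2 _]].
have ch0 : 0 < c * h by rewrite mulr_gt0 ?c_gt0 ?h_gt0.
have g1 := geo_step a g; have [r1 t1] := ray_step alphaP g r v1.
have g2 := geo_step (~~ a) g1; have [r2 t2] := ray_step alphaP g1 r1 v2.
have [t t01 [S1 S2]] := tau_coord r; have [t' t01' [R1 R2]] := tau_coord r2.
have T0 := ltW (lt_trans t1 t2); rewrite -subr_ge0 in T0.
have [p o] := g.
rewrite -lerBrDl.
case: a {v1 v2 t1 t2 g2 r1 r2} g1 R1 R2 T0 => g1 R1 R2 T0.
  have [eL eR [A01 dA eW]] := step_true g.
  have [eL' eR' _] := step_false g1.
  rewrite eL' eR' eL eW /= in R1 R2.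
  have B := vtx_dist2_bounds alphaP (fr s) (perm3_swap23 (perm3_swap12 p)).
  apply: (@kite_points (Rp alpha s) (Lp alpha s) (Wp alpha s) y
    (fcoef alpha s true) (1 - t') t _ y0h B dA _ A01 _ _ T0).
  - suff -> : cross3 (Rp alpha s) (Wp alpha s) (Lp alpha s) = c * h.
      by rewrite gtr0_norm.
    by rewrite -o /cross3; ring.
  - by case/andP: t01' => ? ?; apply/andP; split; lra.
  - by case/andP: t01 => ? ?; apply/andP; split; lra.
  - by rewrite mulrBl R1 S1; ring.
  - by rewrite mulrBl R2 S2; ring.
have [eL eR [A01 dA eW]] := step_false g.
have [eL' eR' _] := step_true g1.
rewrite eL' eR' eR eW /= in R1 R2.
have B := vtx_dist2_bounds alphaP (fr s) (perm3_swap23 p).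
apply: (@kite_points (Lp alpha s) (Rp alpha s) (Wp alpha s) y
  (fcoef alpha s false) t' (1 - t) _ y0h B dA _ A01 _ _ T0).
- suff -> : cross3 (Lp alpha s) (Wp alpha s) (Rp alpha s) = - (c * h).
    by rewrite normrN gtr0_norm.
  by rewrite -o /cross3; ring.
- by case/andP: t01' => ? ?; apply/andP; split; lra.
- by case/andP: t01 => ? ?; apply/andP; split; lra.
- by rewrite mulrBl R1 S1; ring.
- by rewrite mulrBl R2 S2; ring.
Qed.

(** * Pivoting around a single vertex *)

Definition spread (s : state R) y := cr alpha y (Lp alpha s) - cr alpha y (Rp alpha s).

(** Measured from the pivot and across the ray, a new outer vertex is [2 A] times the previous one
    minus the one before. *)
Lemma spread_step2 s y a : geo alpha s ->
  spread (step alpha (step alpha s a) a) y =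
  2 * fcoef alpha s a * spread (step alpha s a) y - spread s y.
Proof.
move=> g; rewrite /spread; have g1 := geo_step a g; case: a g1 => g1.
  have [-> -> _] := step_true g1.
  by have [-> -> [_ _ ->]] := step_true g; rewrite /cr /=; ring.
have [-> -> _] := step_false g1.
by have [-> -> [_ _ ->]] := step_false g; rewrite /cr /=; ring.
Qed.

(** Two pivoting steps rotate the side about the pivot by twice the angle [theta] there, so the
    coefficient is [2 cos (2 theta)], that is [4 cos^2 theta - 2]; it stays away from 2. *)
Lemma spread_step4 s y a : geo alpha s -> let s2 := step alpha (step alpha s a) a in
  exists2 k, k <= 2 - 4 * (c * h) ^+ 2 &
  spread (step alpha (step alpha s2 a) a) y = k * spread s2 y - spread s y.
Proof.
move=> g s2; have g1 := geo_step a g; have g2 := geo_step a g1.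
exists (4 * (fcoef alpha s a * fcoef alpha (step alpha s a) a) - 2).
  suff : fcoef alpha s a * fcoef alpha (step alpha s a) a <= 1 - (c * h) ^+ 2 by lra.
  case: g => p _; case: a {g1 g2 s2}; rewrite /fcoef /step /=; apply: refcoef_mul_le.
    exact: (perm3_swap23 (perm3_swap12 p)).
  exact: (perm3_swap23 p).
rewrite (spread_step2 y a g2) (spread_step2 y a g1) -/s2.
have -> : fcoef alpha s2 a = fcoef alpha s a by case: a @s2 {g1 g2}.
have := spread_step2 y a g; rewrite -/s2 => E.
have {}E : 2 * fcoef alpha s a * spread (step alpha s a) y = spread s2 y + spread s y by lra.
rewrite mulrBr E; ring.
Qed.

Lemma spread_gt0 s y : ray alpha s y -> 0 < spread s y.
Proof. by rewrite /spread => -[]; lra. Qed.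

(* The ratio rho of successive spreads satisfies rho' = k - 1 / rho with k < 2,
   hence rho' <= rho - (2 - k): the ray cannot pivot around one vertex for long. *)
Lemma pivot_ratio n s y a rho : geo alpha s -> ray alpha s y -> rho <= 2 ->
  valid alpha s y (nseq (n.+1).*2 a) ->
  spread (step alpha (step alpha s a) a) y <= rho * spread s y ->
  4 * (c * h) ^+ 2 * n%:R < rho.
Proof.
elim: n s rho => [|n IH] s rho g r rho2 v le.
  rewrite mulr0; case: v => v1 [v2 _].
  have [r1 _] := ray_step alphaP g r v1.
  have [r2 _] := ray_step alphaP (geo_step a g) r1 v2.
  have := spread_gt0 r2; have S0 := spread_gt0 r => S2.
  by rewrite -(pmulr_lgt0 _ S0); apply: lt_le_trans le.
case: v => v1 [v2 v].
have g1 := geo_step a g; have g2 := geo_step a g1.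
have [r1 _] := ray_step alphaP g r v1.
have [r2 _] := ray_step alphaP g1 r1 v2.
have [k k2 E] := spread_step4 y a g.
suff : 4 * (c * h) ^+ 2 * n%:R < rho - 4 * (c * h) ^+ 2 by rewrite -natr1; lra.
apply: (IH _ _ g2 r2 _ v); first by have := sqr_ge0 (c * h); lra.
rewrite E.
have S0 := spread_gt0 r; have S2 := spread_gt0 r2.
(* This is [2 - rho <= 1 / rho] in a form free of division. *)
have X : (2 - rho) * spread (step alpha (step alpha s a) a) y <= spread s y.
  apply: (@le_trans _ _ ((2 - rho) * (rho * spread s y))).
    by rewrite ler_wpM2l // subr_ge0.
  by have := mulr_ge0 (sqr_ge0 (rho - 1)) (ltW S0); lra.
have Y : k * spread (step alpha (step alpha s a) a) y <=
   (2 - 4 * (c * h) ^+ 2) * spread (step alpha (step alpha s a) a) y.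
  by rewrite ler_wpM2r // ltW.
by lra.
Qed.

Definition pivot_bound : nat := (Num.trunc ((2 * (c * h) ^+ 2)^-1)).+1.

(** The first two turns serve to obtain the starting ratio [rho = 2] from [spread_step4];
    [pivot_bound] is then large enough to contradict [pivot_ratio]. *)
Lemma no_long_pivot s y a : geo alpha s -> ray alpha s y ->
  ~ valid alpha s y (nseq (pivot_bound.+2).*2 a).
Proof.
move=> g r [v1 [v2 v]].
have g1 := geo_step a g; have g2 := geo_step a g1.
have [r1 _] := ray_step alphaP g r v1.
have [r2 _] := ray_step alphaP g1 r1 v2.
have [k k2 E] := spread_step4 y a g.
have ch0 : 0 < c * h by rewrite mulr_gt0 ?c_gt0 ?h_gt0.
have q0 : 0 < (c * h) ^+ 2 by rewrite exprn_gt0.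
have := @pivot_ratio pivot_bound _ _ _ _ g2 r2 (lexx 2) v; rewrite E.
have S0 := spread_gt0 r; have S2 := spread_gt0 r2.
have Y : k * spread (step alpha (step alpha s a) a) y <=
   (2 - 4 * (c * h) ^+ 2) * spread (step alpha (step alpha s a) a) y.
  by rewrite ler_wpM2r // ltW.
have Z := mulr_gt0 q0 S2.
move=> H; have {}H : 4 * (c * h) ^+ 2 * pivot_bound%:R < 2 by apply: H; lra.
have p0 : 0 < 2 * (c * h) ^+ 2 by rewrite mulr_gt0.
have : (2 * (c * h) ^+ 2)^-1 < pivot_bound%:R by apply: truncnS_gt.
by rewrite -(ltr_pM2l p0) mulfV ?gt_eqF //; lra.
Qed.

Definition pivot_len : nat := (pivot_bound.+2).*2.

(** The word is too long to be constant, so two consecutive letters differ and [tau_zigzag] applies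
    there; elsewhere the time does not decrease. *)
Lemma tau_block s y b : 0 < y < h -> geo alpha s -> ray alpha s y ->
  valid alpha s y b -> (pivot_len < size b)%N ->
  tau alpha s y + (c * h) ^+ 2 / 2 <= tau alpha (foldl (step alpha) s b) y.
Proof.
move=> y0h g r v sb.
case: b v sb => [//|a b] v sb.
have [e|/allPn[a' a'b na]] := boolP (all (pred1 a) b).
  case: (no_long_pivot (a := a) g r).
  move/all_pred1P: e => e; move: v; rewrite e.
  have -> : a :: nseq (size b) a =
     nseq pivot_len a ++ nseq ((size b).+1 - pivot_len) a.
    by rewrite -nseqD subnKC // ltnW.
  by case/valid_cat.
have aa' : a' = ~~ a by case: a a' na {v sb a'b} => [] [].
have [b1 [b2 E]] : exists b1 b2, a :: b = b1 ++ [:: a; ~~ a] ++ b2.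
  rewrite aa' in a'b; clear v sb aa' na a'.
  elim: b a'b => //= x b IH.
  have [->|xa] := eqVneq x a.
    rewrite inE; case: eqP => [|_]; first by case: (a).
    by move/IH=> [b1 [b2 ->]]; exists (a :: b1), b2.
  by move=> _; exists [::], b; case: a x xa {IH} => [] [].
rewrite {}E in v *; move: v => /valid_cat[v1 /valid_cat[v2 v3]].
rewrite !foldl_cat.
set s1 := foldl _ s b1 in v2 v3 *.
have g1 : geo alpha s1 by apply: geo_run.
have r1 : ray alpha s1 y by apply: ray_run v1.
have t1 : tau alpha s y <= tau alpha s1 y by apply: tau_run v1.
have r2 := ray_run alphaP g1 r1 v2.
have t3 := tau_run alphaP (geo_run [:: a; ~~ a] g1) r2 v3.
have := tau_zigzag y0h g1 r1 v2.
by move: t3 => /=; lra.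
Qed.

Lemma tau_growth k s y b : 0 < y < h -> geo alpha s -> ray alpha s y ->
  valid alpha s y b -> (k * pivot_len.+1 <= size b)%N ->
  tau alpha s y + k%:R * ((c * h) ^+ 2 / 2) <=
  tau alpha (foldl (step alpha) s b) y.
Proof.
move=> y0h; elim: k s b => [|k IH] s b g r v sb.
  by rewrite mul0r addr0; apply: tau_run.
have sb1 : (pivot_len.+1 <= size b)%N by lia.
rewrite -(cat_take_drop pivot_len.+1 b) in v *.
move: v => /valid_cat[v1 v2]; rewrite foldl_cat.
have st : size (take pivot_len.+1 b) = pivot_len.+1 by rewrite size_takel.
have := tau_block y0h g r v1; rewrite st => /(_ (ltnSn _)).
have := IH _ _ (geo_run _ g) (ray_run alphaP g r v1) v2; rewrite size_drop.
have sb2 : (k * pivot_len.+1 <= size b - pivot_len.+1)%N by lia.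
by move=> /(_ sb2); rewrite -natr1; lra.
Qed.

(** The word is cut into blocks of length [pivot_len.+1]; the [- 1] pays for the incomplete last
    block. *)
Lemma tau_linear : exists2 kappa : R, 0 < kappa & forall s y b,
  0 < y < h -> geo alpha s -> ray alpha s y -> valid alpha s y b ->
  kappa * (size b)%:R - 1 <= tau alpha (foldl (step alpha) s b) y.
Proof.
have ch0 : 0 < c * h by rewrite mulr_gt0 ?c_gt0 ?h_gt0.
have ch2 : c * h <= 1.
  by have := sqr_ge0 (c - h); have := cos2Dsin2 alpha; rewrite sqrrB; lra.
have q0 : 0 < (c * h) ^+ 2 / 2 by rewrite divr_gt0 // exprn_gt0.
have q1 : (c * h) ^+ 2 / 2 <= 1.
  by have := exprn_ile1 2 (ltW ch0) ch2; lra.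
exists ((c * h) ^+ 2 / 2 / pivot_len.+1%:R); first by rewrite divr_gt0.
move=> s y b y0h g r v.
have sd := divn_eq (size b) pivot_len.+1.
have sm := ltn_pmod (size b) (ltn0Sn pivot_len).
have := tau_growth y0h g r v (leq_divM _ _).
move/(le_trans _); apply; have t0 := tau_gt0 r.
suff : (c * h) ^+ 2 / 2 / pivot_len.+1%:R * (size b)%:R <=
   (size b %/ pivot_len.+1)%:R * ((c * h) ^+ 2 / 2) + (c * h) ^+ 2 / 2.
  move=> le; rewrite lerBlDr (le_trans le) //.
  by rewrite -addrA [_%:R * _ + 1]addrC addrA [_ + _%:R * _]addrC lerD2l; lra.
rewrite mulrAC ler_pdivrMr ?ltr0n //.
rewrite (_ : _ + _ = (c * h) ^+ 2 / 2 * ((size b %/ pivot_len.+1).+1%:R)); last first.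
  by rewrite -natr1; ring.
by rewrite -[leRHS]mulrA ler_pM2l // -natrM ler_nat mulSn addnC {1}sd leq_add2l ltnW.
Qed.

End Growth.

(** * The tree of itineraries *)

Section Tree.
Variables (R : realType) (alpha : R).
Hypothesis alphaP : 0 < alpha < pi / 2.

Local Notation c := (cos alpha).
Local Notation h := (sin alpha).

Definition hits (s : state R) (y : R) (b : seq bool) : Prop :=
  valid alpha s y b /\ cr alpha y (Wp alpha (foldl (step alpha) s b)) = 0.

(** The rays with [lo < y < hi] sorted by itinerary: [cuts] holds the values that hit a vertex, [lv]
    the words of length [n] with their intervals. Through [tree_size], a lower bound on the number
    of leaves is one on the number of cuts. *)
Record unfolding_tree n (s : state R) (lo hi : R) (cuts : seq R)
    (lv : seq (seq bool * (R * R))) : Prop := UnfoldingTree {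
  tree_uniq_cuts : uniq cuts;
  tree_cuts : forall y, y \in cuts -> lo < y < hi /\
    exists2 b, (size b < n)%N & hits s y b;
  tree_size : size lv = (size cuts).+1;
  tree_uniq : uniq (map fst lv);
  tree_leaf : forall x, x \in lv -> [/\ size x.1 = n, lo <= x.2.1,
    x.2.1 < x.2.2, x.2.2 <= hi &
    forall y, x.2.1 < y < x.2.2 -> valid alpha s y x.1];
  tree_sum : \sum_(x <- lv) (x.2.2 - x.2.1) = hi - lo;
  tree_complete : forall b y, lo < y < hi -> size b = n -> valid alpha s y b ->
    b \in map fst lv }.

Lemma cr_affine y y' Z : cr alpha y' Z = cr alpha y Z - (y' - y) * Z.1.
Proof. by rewrite /cr; ring. Qed.

(** By a determinant identity like that of [ray_step], the vertex hit lies beyond the side just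
    crossed. *)
Lemma hit_tau s y : geo alpha s -> ray alpha s y ->
  cr alpha y (Wp alpha s) = 0 -> tau alpha s y < (Wp alpha s).1 / c.
Proof.
move=> [_ o] [l0 r0 d0] w0.
have c0 := c_gt0 alphaP; have h0 := h_gt0 alphaP.
have D0 : 0 < cr alpha y (Lp alpha s) - cr alpha y (Rp alpha s) by lra.
have r1 : - cr alpha y (Rp alpha s) != 0 by rewrite oppr_eq0 lt_eqF.
have E : (Wp alpha s).1 * (cr alpha y (Lp alpha s) - cr alpha y (Rp alpha s)) =
    c * det2 (Rp alpha s) (Lp alpha s) + c * (c * h).
  apply: (mulfI r1); rewrite -o.
  have {}w0 : c * (Wp alpha s).2 = y * (Wp alpha s).1 by exact: subr0_eq.
  by rewrite /det2 /cr /cross3; ring: w0.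
rewrite /tau ltr_pdivrMr // mulrAC ltr_pdivlMr // E mulrC.
by rewrite -subr_gt0 addrAC subrr add0r !mulr_gt0.
Qed.

Lemma hit_front s y : geo alpha s -> ray alpha s y ->
  cr alpha y (Wp alpha s) = 0 -> 0 < (Wp alpha s).1.
Proof.
move=> g r w0; have := lt_trans (tau_gt0 r) (hit_tau g r w0).
by rewrite pmulr_lgt0 // invr_gt0 c_gt0.
Qed.

Definition grow (a : bool) (x : seq bool * (R * R)) := (a :: x.1, x.2).

Lemma map_fst_grow a (lv : seq (seq bool * (R * R))) :
  map fst (map (grow a) lv) = map (cons a) (map fst lv).
Proof. by rewrite -!map_comp. Qed.

Lemma hits_cons s y a b : turn alpha s y a -> hits (step alpha s a) y b ->
  hits s y (a :: b).
Proof. by move=> t [v w]; split. Qed.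

Lemma tree_single n s lo hi cuts lv a :
  (forall y, lo < y < hi -> turn alpha s y a) ->
  unfolding_tree n (step alpha s a) lo hi cuts lv ->
  unfolding_tree n.+1 s lo hi cuts (map (grow a) lv).
Proof.
move=> t [u1 u2 u3 u4 u5 u6 u7]; split.
- by [].
- move=> y /u2[y1 [b bn hb]]; split=> //; exists (a :: b) => //.
  exact: hits_cons (t _ y1) hb.
- by rewrite size_map.
- by rewrite map_fst_grow map_inj_uniq // => b b' [].
- move=> _ /mapP[x /u5[x1 x2 x3 x4 x5] ->]; split=> //=; first by rewrite x1.
  move=> y /andP[y1 y2]; split; last by apply: x5; rewrite y1 y2.
  by apply: t; rewrite (le_lt_trans x2 y1) (lt_le_trans y2 x4).
- by rewrite big_map.
- move=> [//|a' b] y yI [bn] [ta v]; rewrite map_fst_grow.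
  have aa : a' = a.
    have := t _ yI; case: a a' ta {t v u1 u2 u3 u4 u5 u6 u7} => [] [] //=; lra.
  by rewrite aa map_f //; apply: u7 yI _ _ => //; rewrite -aa.
Qed.

Lemma tree_split n s lo y0 hi cuts1 lv1 cuts2 lv2 : lo < y0 < hi ->
  cr alpha y0 (Wp alpha s) = 0 ->
  (forall y, lo < y < y0 -> turn alpha s y true) ->
  (forall y, y0 < y < hi -> turn alpha s y false) ->
  unfolding_tree n (step alpha s true) lo y0 cuts1 lv1 ->
  unfolding_tree n (step alpha s false) y0 hi cuts2 lv2 ->
  unfolding_tree n.+1 s lo hi (cuts1 ++ y0 :: cuts2)
    (map (grow true) lv1 ++ map (grow false) lv2).
Proof.
move=> /andP[y01 y02] w0 t1 t2 [u1 u2 u3 u4 u5 u6 u7] [v1 v2 v3 v4 v5 v6 v7].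
split.
- rewrite cat_uniq u1 andTb cons_uniq v1 andbT; apply/andP; split.
    apply/hasPn => y; rewrite inE => /orP[/eqP ->|/v2[/andP[a1 a2] _]].
      by apply/negP => /u2[/andP[_]]; rewrite ltxx.
    by apply/negP => /u2[/andP[_ a3] _]; have := lt_trans a1 a3; rewrite ltxx.
  by apply/negP => /v2[/andP[]]; rewrite ltxx.
- move=> y; rewrite mem_cat inE => /or3P[/u2|/eqP ->|/v2].
  + move=> [/andP[a1 a2] [b bn hb]]; split; first by rewrite a1 (lt_trans a2).
    by exists (true :: b) => //; apply: hits_cons hb; apply: t1; rewrite a1.
  + by rewrite y01 y02; split=> //; exists [::].
  + move=> [/andP[a1 a2] [b bn hb]]; split; first by rewrite a2 (lt_trans y01).
    by exists (false :: b) => //; apply: hits_cons hb; apply: t2; rewrite a1.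
- by rewrite !size_cat !size_map u3 v3 addSn.
- have inj a : injective (cons a : seq bool -> seq bool) by move=> b b' [].
  rewrite map_cat !map_fst_grow cat_uniq !(map_inj_uniq (inj _)) u4 v4 andbT andTb.
  by apply/hasPn => x /mapP[b _ e]; apply/negP => /mapP[b' _]; rewrite e.
- move=> x0; rewrite mem_cat => /orP[] /mapP[x].
  + move=> /u5[x1 x2 x3 x4 x5] ->; split=> //=; first by rewrite x1.
      by apply: le_trans x4 (ltW y02).
    move=> y /andP[a1 a2]; split; last by apply: x5; rewrite a1 a2.
    by apply: t1; rewrite (le_lt_trans x2 a1) (lt_le_trans a2 x4).
  + move=> /v5[x1 x2 x3 x4 x5] ->; split=> //=; first by rewrite x1.
      by apply: le_trans (ltW y01) x2.
    move=> y /andP[a1 a2]; split; last by apply: x5; rewrite a1 a2.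
    by apply: t2; rewrite (le_lt_trans x2 a1) (lt_le_trans a2 x4).
- by rewrite big_cat !big_map /= u6 v6; ring.
- move=> [//|a b] y /andP[a1 a2] [bn] [ta v]; rewrite map_cat mem_cat !map_fst_grow.
  have [yy|yy|yy] := ltgtP y y0; last first.
  + by move: ta; rewrite yy /turn w0 ltxx; case: a {v}.
  + have := t2 y; rewrite yy a2 => /(_ isT) t.
    have af : a = false by case: a ta {v} => //= ta; move: t => /=; lra.
    rewrite af in v *; apply/orP; right; apply: map_f.
    by apply: (v7 b y) => //; rewrite yy.
  + have := t1 y; rewrite yy a1 => /(_ isT) t.
    have af : a = true by case: a ta {v} => //= ta; move: t => /=; lra.
    rewrite af in v *; apply/orP; left; apply: map_f.
    by apply: (u7 b y) => //; rewrite a1.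
Qed.

Lemma unfolding_tree_exists n s lo hi : geo alpha s -> lo < hi ->
  (forall y, lo < y < hi -> ray alpha s y) ->
  exists cuts lv, unfolding_tree n s lo hi cuts lv.
Proof.
elim: n s lo hi => [|n IH] s lo hi g lh r.
  exists [::], [:: ([::], (lo, hi))]; split=> //.
  - by move=> x; rewrite inE => /eqP ->; split=> //=; rewrite lexx.
  - by rewrite big_seq1.
  - by move=> b y _ /size0nil ->; rewrite inE.
have single a : (forall y, lo < y < hi -> turn alpha s y a) ->
    exists cuts lv, unfolding_tree n.+1 s lo hi cuts lv.
  move=> t; have [|cuts [lv T]] := IH (step alpha s a) lo hi (geo_step a g) lh.
    by move=> y yI; have [] := ray_step alphaP g (r y yI) (t y yI).
  by exists cuts, (map (grow a) lv); apply: tree_single.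
have [[y0 [y0I w0]]|N] :=
    pselect (exists y, lo < y < hi /\ cr alpha y (Wp alpha s) = 0).
  (* [cr y (Wp s)] is affine in [y] with slope [- (Wp s).1 < 0]: below [y0] the vertex is on the
     left of the ray, above [y0] on its right. *)
  have W0 := hit_front g (r y0 y0I) w0.
  have [y01 y02] := andP y0I.
  have t1 y : lo < y < y0 -> turn alpha s y true.
    by case/andP=> a1 a2; rewrite /= (cr_affine y0) w0 sub0r -mulNr mulr_gt0 //; lra.
  have t2 y : y0 < y < hi -> turn alpha s y false.
    by case/andP=> a1 a2; rewrite /= (cr_affine y0) w0 sub0r oppr_lt0 mulr_gt0 //; lra.
  have [|cuts1 [lv1 T1]] := IH (step alpha s true) lo y0 (geo_step true g) y01.
    move=> y yI; have [] := @ray_step _ _ alphaP s y true g _ (t1 y yI) => //.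
    by apply: r; case/andP: yI => -> a2; apply: lt_trans y02.
  have [|cuts2 [lv2 T2]] := IH (step alpha s false) y0 hi (geo_step false g) y02.
    move=> y yI; have [] := @ray_step _ _ alphaP s y false g _ (t2 y yI) => //.
    by apply: r; case/andP: yI => a1 ->; rewrite (lt_trans y01 a1).
  exists (cuts1 ++ y0 :: cuts2), (map (grow true) lv1 ++ map (grow false) lv2).
  exact: tree_split y0I w0 t1 t2 T1 T2.
have nz y : lo < y < hi -> cr alpha y (Wp alpha s) != 0.
  by move=> yI; apply/eqP => w0; apply: N; exists y.
set m := (lo + hi) / 2.
have mI : lo < m < hi by apply/andP; split; rewrite /m; lra.
have same y : lo < y < hi ->
    0 < cr alpha y (Wp alpha s) * cr alpha m (Wp alpha s).
  move=> yI; rewrite lt_neqAle eq_sym mulf_neq0 ?nz //= leNgt; apply/negP => neg.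
  set gy := cr alpha y (Wp alpha s) in neg *; set gm := cr alpha m (Wp alpha s) in neg *.
  have d0 : gm - gy != 0.
    apply/eqP => /subr0_eq e; move: neg.
    by rewrite e -expr2 ltNge sqr_ge0.
  (* The zero of the affine function, by linear interpolation; opposite signs at [y] and [m] put it
     inside the interval. *)
  pose z := (y * gm - m * gy) / (gm - gy).
  have [/andP[y1 y2] /andP[m1 m2]] := (yI, mI).
  have: lo < z < hi.
    rewrite /z; have [dp|dn] := ltP 0 (gm - gy).
      rewrite ltr_pdivlMr // ltr_pdivrMr //; apply/andP; split; nra.
    have {}dn : gm - gy < 0 by rewrite lt_neqAle d0.
    rewrite ltr_ndivlMr // ltr_ndivrMr //; apply/andP; split; nra.
  move/nz/eqP; apply; rewrite (cr_affine y) -/gy.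
  have e : gm = gy - (m - y) * (Wp alpha s).1 by rewrite /gm (cr_affine y).
  have zE : z * (gm - gy) = y * (gm - gy) - (m - y) * gy.
    by rewrite divfK //; ring.
  apply: (mulIf d0); rewrite mul0r.
  transitivity (gy * (gm - gy) -
    (z * (gm - gy) - y * (gm - gy)) * (Wp alpha s).1); first by ring.
  rewrite zE; have {}e : gm - gy = - ((m - y) * (Wp alpha s).1) by rewrite e; ring.
  by rewrite e; ring.
have [p|p] := ltP 0 (cr alpha m (Wp alpha s)).
  by apply: (single true) => y /same; rewrite pmulr_lgt0.
apply: (single false) => y yI; have := same y yI.
have {}p : cr alpha m (Wp alpha s) < 0 by rewrite lt_neqAle nz.
by rewrite nmulr_lgt0.
Qed.

End Tree.

(** * Strips without vertices *)

Section Strip.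
Variables (R : realType) (alpha : R).
Hypothesis alphaP : 0 < alpha < pi / 2.

Local Notation c := (cos alpha).
Local Notation h := (sin alpha).

(** * Translates of a state, and hypotenuses as barriers *)

Definition shift (v : R * R) (s : state R) : state R :=
  let f := fr s in
  State (Frame (apx f + v.1) (apy f + v.2) (lev f) (eps f) (sig f))
    (lft s) (rgt s) (far s).

Lemma vtx_shift v s j : vtx alpha (fr (shift v s)) j =
  ((vtx alpha (fr s) j).1 + v.1, (vtx alpha (fr s) j).2 + v.2).
Proof.
by case: s => [[x y k e g] l r f]; case: j => [|[|j]]; rewrite /vtx /=; congr pair; ring.
Qed.

Lemma cr_vtx_shift y v s j : cr alpha y (vtx alpha (fr (shift v s)) j) =
  cr alpha y (vtx alpha (fr s) j) + cr alpha y v.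
Proof. by rewrite vtx_shift /cr /=; ring. Qed.

Lemma step_shift v s a : step alpha (shift v s) a = shift v (step alpha s a).
Proof.
case: s => [[x y k e g] l r f]; rewrite /step /shift /=.
by case: a; congr State; [case: l => [|[|j]] | case: r => [|[|j]]] => //=;
  congr Frame; ring.
Qed.

Definition same_shape (s s' : state R) : bool :=
  [&& lev (fr s) == lev (fr s'), eps (fr s) == eps (fr s'),
      sig (fr s) == sig (fr s'), lft s == lft s', rgt s == rgt s' &
      far s == far s'].

Lemma same_shape_shift s s' : same_shape s s' ->
  s' = shift ((vtx alpha (fr s') 0).1 - (vtx alpha (fr s) 0).1,
              (vtx alpha (fr s') 0).2 - (vtx alpha (fr s) 0).2) s.
Proof.
case: s s' => [[x y k e g] l r f] [[x' y' k' e' g'] l' r' f'].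
move=> /and5P[/= /eqP-> /eqP-> /eqP-> /eqP-> /andP[/eqP-> /eqP->]].
by rewrite /shift /=; congr State; congr Frame; ring.
Qed.

(** Cross product of the ray direction with the unit vector of angle [(2k + 1) alpha], the direction
    of the hypotenuse shared by a copy of level [k] and one of level [k + 1]. *)
Definition link (y : R) (k : int) : R :=
  c * sin ((2 * k%:~R + 1) * alpha) - y * cos ((2 * k%:~R + 1) * alpha).

Lemma hyp_spread s y : perm3 (lft s) (rgt s) (far s) -> far s = 1%N ->
  `|spread alpha s y| =
  `|link y (if sig (fr s) then lev (fr s) else lev (fr s) - 1)|.
Proof.
move=> p f1; pose d := cr alpha y (vtx alpha (fr s) 2) - cr alpha y (vtx alpha (fr s) 0).
have -> : `|spread alpha s y| = `|d|.
  rewrite /spread /Lp /Rp; case: p f1 => // _; first by rewrite distrC.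
set k := if _ then _ else _.
have -> : d = sg (eps (fr s)) * link y k; last first.
  by rewrite normrM; case: (eps _); rewrite /sg ?normrN ?normr1 mul1r.
have ang : (2 * k%:~R + 1) * alpha =
   (lev (fr s))%:~R * (2 * alpha) + sg (sig (fr s)) * alpha :> R.
  by rewrite /k; case: (sig _); rewrite /sg ?intrD /=; ring.
rewrite /d /cr /link ang sinD cosD /vtx /= -/(rotc alpha _) -/(rots alpha _).
by case: (sig _); rewrite /sg ?mul1r ?mulN1r ?sinN ?cosN; ring.
Qed.

(** The level passes between [k] and [k + 1] only through a hypotenuse of direction [k], whose
    spread is less than [2 * w], whereas a side crossed by the strip has spread at least [2 * w]. *)
Lemma barrier_step s y w k a : geo alpha s ->
  w <= cr alpha y (Lp alpha (step alpha s a)) ->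
  cr alpha y (Rp alpha (step alpha s a)) <= - w ->
  `|link y k| < 2 * w ->
  (lev (fr s) <= k) = (lev (fr (step alpha s a)) <= k).
Proof.
move=> g mL mR bar; have g1 := geo_step a g.
have S2 : 2 * w <= `|spread alpha (step alpha s a) y|.
  by apply: le_trans (ler_norm _); rewrite /spread; lra.
have key j : far (step alpha s a) = j -> fr (step alpha s a) = refl alpha j (fr s) ->
    (lev (fr s) <= k) = (lev (fr (step alpha s a)) <= k).
  move=> fj ->; case: j fj => [|[|j]] //= fj.
  have := hyp_spread y (proj1 g1) fj.
  have -> : fr (step alpha s a) = refl alpha 1 (fr s).
    by move: fj; rewrite /step; case: a {mL mR S2 g1} => /= ->.
  rewrite /= /levstep; case: (sig (fr s)) => /= E.
    have nk : k <> lev (fr s).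
      by move=> e; move: S2; rewrite E /= addrK -e; lra.
    by lia.
  have nk : k <> lev (fr s) - 1.
    by move=> e; move: S2; rewrite E /= -e; lra.
  by lia.
by case: a {mL mR S2 g1} key => key; apply: key.
Qed.

(** * Itineraries of strips and their periodicity *)

Definition stat (b : seq bool) (i : nat) : state R :=
  foldl (step alpha) (st0 alpha) (take i b).

Lemma stat_succ b i : (i < size b)%N ->
  stat b i.+1 = step alpha (stat b i) (nth false b i).
Proof. by move=> ib; rewrite /stat (take_nth false ib) foldl_rcons. Qed.

Lemma geo_stat b i : geo alpha (stat b i).
Proof. exact/geo_run/geo0. Qed.

Lemma valid_take s y b i : valid alpha s y b -> valid alpha s y (take i b).
Proof. by rewrite -{1}(cat_take_drop i b) => /valid_cat[]. Qed.

Lemma turn_stat y b i : (i < size b)%N -> valid alpha (st0 alpha) y b ->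
  turn alpha (stat b i) y (nth false b i).
Proof.
move=> ib; rewrite -{1}(cat_take_drop i b) => /valid_cat[_].
by rewrite (drop_nth false ib) => -[].
Qed.

Definition strip (y w : R) (b : seq bool) (i0 : nat) : Prop :=
  forall i, (i0 <= i <= size b)%N ->
  w <= cr alpha y (Lp alpha (stat b i)) /\ cr alpha y (Rp alpha (stat b i)) <= - w.

Lemma strip_lev y w b i0 k : strip y w b i0 -> `|link y k| < 2 * w ->
  forall i, (i0 <= i <= size b)%N ->
  (lev (fr (stat b i0)) <= k) = (lev (fr (stat b i)) <= k).
Proof.
move=> st bar; elim=> [|i IH] /andP[ii ib]; first by move: ii; rewrite leqn0 => /eqP ->.
move: ii; rewrite leq_eqVlt => /orP[/eqP -> //|]; rewrite ltnS => ii.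
have -> := IH (introT andP (conj ii (ltnW ib))).
have [] := st i.+1; first by rewrite ib ltnW.
rewrite stat_succ // => mL mR.
by apply: barrier_step mL mR bar; apply: geo_stat.
Qed.

Lemma strip_far y w b i0 i : strip y w b i0 -> (i0 <= i < size b)%N ->
  if nth false b i then w <= cr alpha y (Wp alpha (stat b i))
  else cr alpha y (Wp alpha (stat b i)) <= - w.
Proof.
move=> st /andP[ii ib]; have [] := st i.+1; first by rewrite ib ltnW.
rewrite stat_succ //; have g := geo_stat b i; case: (nth false b i).
  by have [-> _ _] := step_true g.
by have [_ -> _] := step_false g.
Qed.

(** The far vertices stay outside the strip, on the side told by the letter, and a translation that
    moves them across by less than [w] cannot exchange the sides. *)
Lemma strip_same_turn y w b i0 i j v :
  strip y w b i0 -> (i0 <= i < size b)%N -> (i0 <= j < size b)%N ->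
  stat b j = shift v (stat b i) -> `|cr alpha y v| < w ->
  nth false b i = nth false b j.
Proof.
move=> st iI jI E; rewrite ltr_norml => /andP[v1 v2].
have := strip_far st iI; have := strip_far st jI.
rewrite E /Wp cr_vtx_shift [far _]/=.
by case: (nth _ _ i); case: (nth _ _ j) => //; lra.
Qed.

(** By induction the two states take the same turns, so they remain translates of each other by the
    same [v]. *)
Lemma strip_periodic y w b i0 i j v :
  strip y w b i0 -> (i0 <= i)%N -> (i < j)%N ->
  stat b j = shift v (stat b i) -> `|cr alpha y v| < w ->
  forall a, (i <= a)%N -> (a + (j - i) < size b)%N ->
  nth false b a = nth false b (a + (j - i)).
Proof.
move=> st ii ij E small a ia sa.
suff H k : (j + k < size b)%N -> stat b (j + k) = shift v (stat b (i + k)).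
  apply: strip_same_turn st _ _ _ small; rewrite ?sa ?(leq_trans ii ia) //=; try lia.
  have -> : (a + (j - i) = j + (a - i))%N by lia.
  by rewrite H ?subnKC //; lia.
elim: k => [|k IH] jk; first by rewrite !addn0.
have {}IH : stat b (j + k) = shift v (stat b (i + k)) by apply: IH; lia.
rewrite !addnS !stat_succ ?IH; try lia.
by rewrite step_shift (strip_same_turn st _ _ IH small) //; lia.
Qed.

(** Pigeonhole key: the state up to translation, together with the cell of width [w] containing [cr]
    of its left end. The type has [(2q + 1) * 108 * (B + 1)] elements; [inord] is faithful only in
    the ranges assumed by [shape_eq]. *)
Definition shape (w : R) (y : R) (k : int) (q B : nat) (s : state R) :
    'I_q.*2.+1 * bool * bool * 'I_3 * 'I_3 * 'I_3 * 'I_B.+1 :=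
  (inord `|lev (fr s) - k|%N, eps (fr s), sig (fr s),
   inord (lft s), inord (rgt s), inord (far s),
   inord (Num.trunc (cr alpha y (Lp alpha s) / w))).

Lemma geo_lab s : geo alpha s -> [/\ (lft s < 3)%N, (rgt s < 3)%N & (far s < 3)%N].
Proof. by case=> p _; case: p. Qed.

Lemma shape_eq w y k q B s s' : 0 < w -> geo alpha s -> geo alpha s' ->
  k <= lev (fr s) <= k + (q.*2)%:Z -> k <= lev (fr s') <= k + (q.*2)%:Z ->
  0 <= cr alpha y (Lp alpha s) <= 1 -> 0 <= cr alpha y (Lp alpha s') <= 1 ->
  w^-1 < B%:R ->
  shape w y k q B s = shape w y k q B s' ->
  exists2 v, s' = shift v s & `|cr alpha y v| < w.
Proof.
move=> w0 g g' ks ks' l1 l1' wB.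
have [a1 a2 a3] := geo_lab g; have [a1' a2' a3'] := geo_lab g'.
have iv (x : R) : 0 <= x <= 1 -> (Num.trunc (x / w) < B.+1)%N.
  move=> /andP[x0 x1]; rewrite ltnS truncn_le_nat.
  apply: (@le_lt_trans _ _ w^-1); first by rewrite ler_piMl // invr_ge0 ltW.
  by apply: lt_trans wB _; rewrite ltr_nat.
case=> /(congr1 val) e1 e2 e3 /(congr1 val) e4 /(congr1 val) e5.
move=> /(congr1 val) e6 /(congr1 val) e7.
rewrite /= !inordK ?iv // in e1 e4 e5 e6 e7; try lia.
have sh : same_shape s s'.
  by rewrite /same_shape e2 e3 e4 e5 e6 !eqxx !andbT; apply/eqP; lia.
have E := same_shape_shift sh; move: E; set v := (_, _) => E.
exists v => //.
have -> : cr alpha y v = cr alpha y (Lp alpha s') - cr alpha y (Lp alpha s).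
  by rewrite E /Lp cr_vtx_shift [lft _]/=; ring.
move: e7 l1 l1'; move: (cr alpha y _) => x; move: (cr alpha y _) => x' e7.
move=> /andP[x'0 _] /andP[x0 _].
have := truncn_itv (divr_ge0 x0 (ltW w0)); have := truncn_itv (divr_ge0 x'0 (ltW w0)).
rewrite e7 -natr1; move: (Num.Def.trunc _)%:R => t /andP[t1 t2] /andP[t3 t4].
rewrite ltr_norml -[x'](divfK (lt0r_neq0 w0)) -[x](divfK (lt0r_neq0 w0)) -mulrBl.
by rewrite -[- w]mulN1r ltr_pM2r // gtr_pMl //; apply/andP; split; lra.
Qed.

Lemma strip_cr_le1 y w b i0 i : 0 < y < h -> 0 < w -> strip y w b i0 ->
  (i0 <= i <= size b)%N -> 0 <= cr alpha y (Lp alpha (stat b i)) <= 1.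
Proof.
move=> y0h w0 st iI; have [mL mR] := st i iI.
have := cr_le1 alphaP y0h (side_le1 alphaP (geo_stat b i)).
by rewrite ler_norml => /andP[_ le]; apply/andP; split; lra.
Qed.

(** The barriers [k1] and [k2] confine the level to at most [2q] values, so the [m + 1] crossings
    from [i0] on repeat a shape; the two states are then translates, displaced across the strip by
    less than [w]. *)
Lemma strip_period y w b q B i0 m k1 k2 : 0 < y < h -> 0 < w ->
  w^-1 < B%:R -> strip y w b i0 ->
  `|link y k1| < 2 * w -> `|link y k2| < 2 * w ->
  k1 < lev (fr (stat b i0)) <= k2 -> k2 - k1 <= (q.*2)%:Z ->
  (q.*2.+1 * 108 * B.+1 <= m)%N -> (i0 + m <= size b)%N ->
  exists2 T, (0 < T <= m)%N & forall a, (i0 + m <= a)%N -> (a + T < size b)%N ->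
    nth false b a = nth false b (a + T).
Proof.
move=> y0h w0 wB st b1 b2 kI k12 mB mb.
pose f (i : 'I_m.+1) := shape w y (k1 + 1) q B (stat b (i0 + i)).
have iI (i : 'I_m.+1) : (i0 <= i0 + i <= size b)%N by case: i => /= i; lia.
have lI (i : 'I_m.+1) :
    k1 + 1 <= lev (fr (stat b (i0 + i))) <= k1 + 1 + (q.*2)%:Z.
  by have := strip_lev st b1 (iI i); have := strip_lev st b2 (iI i); lia.
have /injectivePn[i [j ij fij]] : ~~ injectiveb f.
  apply/negP => /injectiveP /leq_card.
  by rewrite !card_prod !card_ord !card_bool; lia.
wlog ltij : i j ij fij / (i < j)%N.
  by move=> W; have [ji|ji|/val_inj e] := ltngtP i j;
    [apply: (W i j) | apply: (W j i) => //; rewrite eq_sym | rewrite e eqxx in ij].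
have l1 i' := strip_cr_le1 y0h w0 st (iI i').
have [v E small] := shape_eq w0 (geo_stat _ _) (geo_stat _ _) (lI i) (lI j)
  (l1 i) (l1 j) wB fij.
exists (j - i)%N; first by case: j {fij ij lI E iI l1} ltij => /= j; lia.
move=> a ia; have := @strip_periodic y w b i0 (i0 + i) (i0 + j) v st _ _ E small a.
rewrite subnDl ltn_add2l; apply => //; first by rewrite leq_addr.
by case: i {fij ij lI E iI l1 ltij} ia => /= i; lia.
Qed.

End Strip.

(** * Diophantine approximation *)

Section Diophantine.
Variable R : realType.

(** Pigeonhole: [N + 1] fractional parts in [N] boxes of length [1 / N]. *)
Lemma dirichlet_approx (beta : R) (N : nat) : (0 < N)%N ->
  exists d (e : int), (0 < d <= N)%N /\ `|d%:R * beta - e%:~R| < N%:R^-1.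
Proof.
case: N => // n _; pose fr (i : nat) : R := i%:R * beta - (Num.floor (i%:R * beta))%:~R.
have fr01 i : 0 <= fr i < 1.
  have /andP[f1 f2] := floor_itv (i%:R * beta).
  by rewrite /fr subr_ge0 f1 ltrBlDl /= (lt_le_trans f2) // intrD addrC.
pose f (i : 'I_n.+2) : 'I_n.+1 := inord (Num.trunc (fr i * n.+1%:R)).
have fE i : f i = Num.trunc (fr i * n.+1%:R) :> nat.
  rewrite inordK // truncn_lt_nat; last by case/andP: (fr01 i) => ? _; rewrite mulr_ge0.
  by rewrite gtr_pMl ?ltr0n //; case/andP: (fr01 i).
have /injectivePn[i [j ij fij]] : ~~ injectiveb f.
  by apply/negP => /injectiveP /leq_card; rewrite !card_ord ltnn.
wlog ltij : i j ij fij / (i < j)%N.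
  by move=> W; have [ji|ji|/val_inj e] := ltngtP i j;
    [apply: (W i j) | apply: (W j i) => //; rewrite eq_sym | rewrite e eqxx in ij].
exists (j - i)%N, (Num.floor (j%:R * beta) - Num.floor (i%:R * beta)).
split; first by case: j {fij ij} ltij => /= j; lia.
have -> : (j - i)%:R * beta - (Num.floor (j%:R * beta) - Num.floor (i%:R * beta))%:~R
    = fr j - fr i.
  by rewrite /fr natrB ?(ltnW ltij) // intrB; ring.
have n0 : 0 < n.+1%:R :> R by rewrite ltr0n.
rewrite -(ltr_pM2r n0) mulVf ?gt_eqF // -[X in _ * X](gtr0_norm n0) -normrM mulrBl.
have := truncn_itv (mulr_ge0 (proj1 (andP (fr01 i))) (ltW n0)).
have := truncn_itv (mulr_ge0 (proj1 (andP (fr01 j))) (ltW n0)).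
rewrite -!fE fij -natr1 => /andP[a1 a2] /andP[a3 a4].
by rewrite ltr_norml; apply/andP; split; lra.
Qed.

(** Induction on [Q]: each new multiple of [beta] has a positive distance to the integers, at least
    [d], and [N] is enlarged beyond [1 / d]. *)
Lemma irrational_gap (beta : R) (Q : nat) :
  (forall q (p : int), (0 < q)%N -> q%:R * beta <> p%:~R) ->
  exists2 N, (0 < N)%N & forall q (p : int), (0 < q < Q)%N ->
    N%:R^-1 <= `|q%:R * beta - p%:~R|.
Proof.
move=> irr; elim: Q => [|Q [N N0 IH]]; first by exists 1%N => // q p; rewrite ltn0 andbF.
have [->|Q0] := posnP Q; first by exists 1%N => // q p; case: q.
set x := Q%:R * beta; set z := Num.floor x.
have /andP[z1 z2] := floor_itv x; rewrite -/z intrD in z1 z2.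
have z1' : z%:~R < x.
  by rewrite lt_neqAle z1 andbT; apply/eqP => e; apply: (irr Q z).
pose d := Num.min (x - z%:~R) (z%:~R + 1 - x).
have d0 : 0 < d by rewrite lt_min; apply/andP; split; lra.
have dx (p : int) : d <= `|x - p%:~R|.
  have [pz|pz] := leP p z.
    apply: le_trans (ler_norm _); rewrite ge_min; apply/orP; left.
    by rewrite lerB // ler_int.
  rewrite distrC; apply: le_trans (ler_norm _); rewrite ge_min; apply/orP; right.
  by rewrite lerB // -[1]/(1%:~R) -intrD ler_int; lia.
exists (maxn N (Num.trunc d^-1).+1) => [|q p]; first by rewrite leq_max N0.
move=> /andP[q0]; rewrite ltnS leq_eqVlt => /orP[/eqP ->|qQ].
  apply: le_trans (dx p); rewrite invf_ple ?posrE ?ltr0n ?leq_max ?N0 //.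
  apply: le_trans (ltW (truncnS_gt _)) _.
  by rewrite ler_nat leq_maxr.
apply: le_trans (IH q p _); last by rewrite q0.
by rewrite lef_pV2 ?posrE ?ltr0n ?leq_max ?N0 // ler_nat leq_maxl.
Qed.

(** A Dirichlet denominator is divided by the gcd, which does not increase the error; [N1] comes
    from [irrational_gap], which forbids reduced denominators below [Q]. Coprimality is recorded by
    Bezout coefficients for [orbit_approx]. *)
Lemma dirichlet_bezout (beta : R) :
  (forall q (p : int), (0 < q)%N -> q%:R * beta <> p%:~R) ->
  forall Q, exists q : nat, exists p u v : int,
  [/\ (Q <= q)%N, (0 < q)%N, u * p + v * q%:Z = 1 &
      `|q%:R * beta - p%:~R| <= q%:R^-1].
Proof.
move=> irr Q; have [N1 N10 gap] := irrational_gap Q irr.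
have [d [e [/andP[d0 dN] de]]] := dirichlet_approx beta N10.
pose g := gcdn `|e|%N d; have g0 : (0 < g)%N by rewrite gcdn_gt0 d0 orbT.
have [u [v E]] := Bezoutz e d%:Z.
have {}E : u * e + v * d%:Z = g%:Z by rewrite E.
pose q := (d %/ g)%N; have dE : d = (q * g)%N by rewrite divnK // dvdn_gcdr.
have [p pE] : exists p, e = p * g%:Z by apply/dvdzP; rewrite dvdzE dvdn_gcdl.
have q0 : (0 < q)%N by move: d0; rewrite dE; case: (q).
have dist : `|q%:R * beta - p%:~R| <= `|d%:R * beta - e%:~R|.
  have -> : d%:R * beta - e%:~R = g%:R * (q%:R * beta - p%:~R).
    have eg : (g%:Z)%:~R = g%:R :> R by [].
    by rewrite dE pE natrM intrM eg; ring.
  by rewrite normrM ler_peMl // ger0_norm // ler1n.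
exists q, p, u, v; split=> //.
- rewrite leqNgt; apply/negP => qQ.
  have := gap q p; rewrite q0 qQ => /(_ isT) le.
  by have := le_lt_trans (le_trans le dist) de; rewrite ltxx.
- have gz : g%:Z != 0 by lia.
  apply: (mulIf gz); rewrite mul1r; transitivity (u * e + v * d%:Z) => //.
  by rewrite {1}pE {1}dE PoszM; ring.
- apply: (le_trans dist); apply: (le_trans (ltW de)).
  rewrite lef_pV2 ?posrE ?ltr0n // ler_nat; apply: leq_trans dN.
  by rewrite dE leq_pmulr.
Qed.

(** As [p] is invertible modulo [q], the multiples of [p / q] run through all fractions of
    denominator [q] modulo 1. One [1 / q] comes from rounding the target, the other from replacing
    [beta] by [p / q]. *)
Lemma orbit_approx (beta t : R) (q : nat) (p u v : int) : (0 < q)%N ->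
  u * p + v * q%:Z = 1 -> `|q%:R * beta - p%:~R| <= q%:R^-1 ->
  forall k0 : int, exists2 i, (i < q)%N & exists z : int,
  `|(k0 + i%:Z)%:~R * beta - t - z%:~R| <= 2 / q%:R.
Proof.
move=> q0 bez app k0.
set m := Num.floor (q%:R * (t - k0%:~R * beta)).
have /andP[m1 m2] := floor_itv (q%:R * (t - k0%:~R * beta)).
rewrite -/m intrD in m1 m2.
(* [u] inverts [p] modulo [q], so [i p] is congruent to [m]. *)
pose i := `|(m * u %% q%:Z)%Z|%N.
have iE : i%:Z = (m * u %% q%:Z)%Z by rewrite gez0_abs // modz_ge0 //; lia.
have iq : (i < q)%N.
  by have := ltz_pmod (m * u) (ltac:(lia) : 0 < q%:Z); rewrite -iE; lia.
exists i => //.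
have [z zE] : exists z : int, i%:Z * p = m + z * q%:Z.
  exists (- (m * u %/ q%:Z)%Z * p - m * v).
  have E := divz_eq (m * u) q%:Z; rewrite -iE in E.
  have -> : i%:Z = m * u - (m * u %/ q)%Z * q%:Z by rewrite [X in X - _]E addrC addKr.
  have bez' : u * p = 1 - v * q%:Z by rewrite -bez addrK.
  transitivity (m * (u * p) - (m * u %/ q)%Z * q%:Z * p); first by ring.
  by rewrite bez'; ring.
exists z.
have q0' : 0 < q%:R :> R by rewrite ltr0n.
have zE' : i%:R * p%:~R = m%:~R + z%:~R * q%:R :> R.
  by move/(congr1 (intr : int -> R)): zE; rewrite !(intrM, intrD).
rewrite ler_pdivlMr // -[X in _ * X](gtr0_norm q0') -normrM.
have -> : ((k0 + i)%:~R * beta - t - z%:~R) * q%:R =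
   (m%:~R - q%:R * (t - k0%:~R * beta)) + i%:R * (q%:R * beta - p%:~R).
  rewrite intrD; have -> : m%:~R = i%:R * p%:~R - z%:~R * q%:R :> R by rewrite zE' addrK.
  by ring.
have iq1 : `|i%:R * (q%:R * beta - p%:~R)| <= 1.
  rewrite normrM; apply: (@le_trans _ _ (q%:R * q%:R^-1)); last by rewrite mulfV ?gt_eqF.
  by apply: ler_pM => //; rewrite ger0_norm ?ler0n // ler_nat ltnW.
apply: le_trans (ler_normD _ _) _; rewrite -[2]/(1 + 1) lerD //.
by rewrite ler_norml; apply/andP; split; lra.
Qed.

End Diophantine.

(** * Folding back to generalized diagonals *)

Section Folding.
Variables (R : realType) (alpha : R).
Hypothesis alphaP : 0 < alpha < pi / 2.

Local Notation c := (cos alpha).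
Local Notation h := (sin alpha).

(** Linear part of the isometry that carries a copy back to the original triangle. *)
Definition fold_dir (f : frame R) (u : R * R) : R * R :=
  let C := rotc alpha (lev f) in let S := rots alpha (lev f) in
  (sg (eps f) * (C * u.1 + S * u.2),
   sg (eps f) * sg (sig f) * (C * u.2 - S * u.1)).

Definition fold (f : frame R) (Z : R * R) : R * R :=
  fold_dir f (Z.1 - apx f, Z.2 - apy f).

Definition corner (j : nat) : R * R :=
  match j with 0 => (0, 0) | 1 => (c, 0) | _ => (c, h) end.

Lemma fold_vtx f j : fold f (vtx alpha f j) = corner j.
Proof.
have r1 := rot1 alpha (lev f).
have e1 : sg (eps f) * sg (eps f) = 1 :> R by exact: sg_sqr.
have g1 : sg (sig f) * sg (sig f) = 1 :> R by exact: sg_sqr.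
have r2 : rots alpha (lev f) * rots alpha (lev f) = 1 - rotc alpha (lev f) * rotc alpha (lev f).
  by rewrite -r1; ring.
by case: j => [|[|j]]; rewrite /fold /fold_dir /vtx /=; congr pair; ring: r2 e1 g1.
Qed.

Definition lerp (A B : R * R) (t : R) : R * R :=
  (A.1 + t * (B.1 - A.1), A.2 + t * (B.2 - A.2)).

Lemma fold_lerp f A B t : fold f (lerp A B t) = lerp (fold f A) (fold f B) t.
Proof. by rewrite /fold /fold_dir /lerp /=; congr pair; ring. Qed.

Definition pt (Z : R * R) : 'rV[R]_2 := point Z.1 Z.2.

Lemma ptZ a Z : a *: pt Z = pt (a * Z.1, a * Z.2).
Proof. by apply/rowP => i; rewrite !mxE; case: ifP. Qed.

Lemma ptD Z Z' : pt Z + pt Z' = pt (Z.1 + Z'.1, Z.2 + Z'.2).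
Proof. by apply/rowP => i; rewrite !mxE; case: ifP. Qed.

Lemma ptN Z : - pt Z = pt (- Z.1, - Z.2).
Proof. by apply/rowP => i; rewrite !mxE; case: ifP. Qed.

Lemma dot_pt Z Z' : dot (pt Z) (pt Z') = Z.1 * Z'.1 + Z.2 * Z'.2.
Proof. by rewrite /dot !big_ord_recl big_ord0 addr0 !mxE. Qed.

Lemma pt_inj : injective pt.
Proof.
case=> x y [x' y'] e; move/rowP: (e) => /(_ 0); move/rowP: e => /(_ 1).
by rewrite !mxE /= => -> ->.
Qed.

Lemma mirrorZ (e w : 'rV[R]_2) a : mirror e (a *: w) = a *: mirror e w.
Proof.
rewrite /mirror scalerBr scalerA; congr (_ *: _ - _).
have -> : dot (a *: w) e = a * dot w e.
  by rewrite /dot mulr_sumr; apply: eq_bigr => i _; rewrite mxE mulrA.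
by ring.
Qed.

(** Side [j] joins vertices [j] and [j + 1], so the one opposite to [o] has index [o + 1] modulo
    3. *)
Definition side_opp (o : nat) : 'I_3 := inord ((o + 1) %% 3)%N.

Local Notation T := (right_triangle alpha).

Lemma tnth_corner (j : 'I_3) : tnth T j = pt (corner j).
Proof. by case: j => [[|[|[|]]] //= ?]; rewrite (tnth_nth 0). Qed.

Lemma side_opp_ends l r o : perm3 l r o ->
  (tnth T (side_opp o) = pt (corner l) /\ tnth T (ordS (side_opp o)) = pt (corner r)) \/
  (tnth T (side_opp o) = pt (corner r) /\ tnth T (ordS (side_opp o)) = pt (corner l)).
Proof.
by case; rewrite !tnth_corner /side_opp /= !inordK //; (by left) || (by right).
Qed.

Lemma side_lerp l r o t : perm3 l r o -> 0 < t < 1 ->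
  side T (side_opp o) (pt (lerp (corner r) (corner l) t)).
Proof.
move=> p tI; have t'I : 0 < 1 - t < 1 by case/andP: tI => ? ?; apply/andP; split; lra.
rewrite /side; have [[-> ->]|[-> ->]] := side_opp_ends p.
  by exists (1 - t) => //; rewrite !ptZ ptD; congr pt; rewrite /lerp /=; congr pair; ring.
by exists t => //; rewrite !ptZ ptD; congr pt; rewrite /lerp /=; congr pair; ring.
Qed.

(** The reflection law: one unfolded direction, folded by two copies adjacent along a side, gives
    the incoming and the outgoing velocity. *)
Lemma mirror_fold_dir f u o : (o < 3)%N ->
  mirror (side_dir T (side_opp o)) (pt (fold_dir f u)) =
  pt (fold_dir (refl alpha o f) u).
Proof.
move=> o3; have c0 := lt0r_neq0 (c_gt0 alphaP); have h0 := lt0r_neq0 (h_gt0 alphaP).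
have H := hh alpha; have H' := ch1 alpha.
have mE (e w : R * R) : mirror (pt e) (pt w) =
    pt (2 * (w.1 * e.1 + w.2 * e.2) / (e.1 * e.1 + e.2 * e.2) * e.1 - w.1,
        2 * (w.1 * e.1 + w.2 * e.2) / (e.1 * e.1 + e.2 * e.2) * e.2 - w.2).
  by rewrite /mirror !dot_pt ptZ ptN ptD.
have mN (e w : 'rV[R]_2) : mirror (- e) w = mirror e w.
  rewrite /mirror; have -> : dot w (- e) = - dot w e.
    by rewrite /dot -sumrN; apply: eq_bigr => i _; rewrite mxE mulrN.
  have -> : dot (- e) (- e) = dot e e.
    by rewrite /dot; apply: eq_bigr => i _; rewrite mxE mulrNN.
  by rewrite scalerN -scaleNr mulrN mulNr opprK.
have sE l r : perm3 l r o -> mirror (side_dir T (side_opp o)) (pt (fold_dir f u)) =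
    mirror (pt ((corner l).1 - (corner r).1, (corner l).2 - (corner r).2)) (pt (fold_dir f u)).
  move=> p; rewrite /side_dir; have [[-> ->]|[-> ->]] := side_opp_ends p.
    by rewrite -mN opprB ptN ptD.
  by rewrite ptN ptD.
have e0 : sg (~~ eps f) = - sg (eps f) :> R by rewrite sgN.
have s0 : sg (~~ sig f) = - sg (sig f) :> R by rewrite sgN.
have s1 : sg (sig f) * sg (sig f) = 1 :> R by exact: sg_sqr.
case: o o3 sE => [|[|[|]]] // _ sE.
- rewrite (sE _ _ Perm210) mE /=.
  congr pt; rewrite /fold_dir /= e0 s0 subr0 subrr mulr0 add0r mul0r add0r.
  by congr pair; field.
- rewrite (sE _ _ Perm201) mE /=.
  rewrite !subr0 H' divr1.
  congr pt; rewrite /fold_dir /= rotc_step rots_step s0.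
  by congr pair; ring: H s1.
- rewrite (sE _ _ Perm102) mE /=.
  congr pt; rewrite /fold_dir /= s0 !subr0 !mulr0 !addr0.
  by congr pair; field.
Qed.

Definition wt (l r : nat) (t : R) (j : nat) : R :=
  if j == l then t else if j == r then 1 - t else 0.

(** An inner point mixes the barycentric weights of both ends, so it suffices that each corner has
    positive weight at one of them. *)
Lemma segment_interior l r o t l' r' o' t' : perm3 l r o -> perm3 l' r' o' ->
  0 <= t <= 1 -> 0 <= t' <= 1 ->
  (forall j, (j < 3)%N -> 0 < wt l r t j + wt l' r' t' j) ->
  open_segment (pt (lerp (corner r) (corner l) t))
    (pt (lerp (corner r') (corner l') t')) `<=` triangle_interior T.
Proof.
move=> p p' /andP[t0 t1] /andP[t0' t1'] pos _ [s /andP[s0 s1] <-].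
have w0 j : 0 <= wt l r t j by rewrite /wt; do 2 case: ifP => // _; lra.
have w0' j : 0 <= wt l' r' t' j by rewrite /wt; do 2 case: ifP => // _; lra.
exists (fun j : 'I_3 => (1 - s) * wt l r t j + s * wt l' r' t' j).
  split=> [j|].
    have := pos j (ltn_ord j); have := w0' j; have := w0 j.
    move: (wt l r t j) (wt l' r' t' j) => a b; rewrite le_eqVlt => /orP[/eqP <-|a0] b0 ab.
      by rewrite mulr0 add0r mulr_gt0 //; lra.
    apply: ltr_pwDl; first by rewrite mulr_gt0 // subr_gt0.
    by rewrite mulr_ge0 // ltW.
  rewrite !big_ord_recl big_ord0 /=.
  have e l0 r0 o0 (a : R) : perm3 l0 r0 o0 -> wt l0 r0 a 0 + wt l0 r0 a 1 + wt l0 r0 a 2 = 1.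
    by case; rewrite /wt /=; ring.
  have := e _ _ _ t p; have := e _ _ _ t' p'; rewrite /bump /=; nra.
rewrite !big_ord_recl big_ord0 addr0 !tnth_corner /= /bump /= !ptZ !ptD; congr pt.
have e l0 r0 o0 (a : R) : perm3 l0 r0 o0 -> lerp (corner r0) (corner l0) a =
   (wt l0 r0 a 1 * c + wt l0 r0 a 2 * c, wt l0 r0 a 2 * h).
  by case; rewrite /lerp /wt /=; congr pair; ring.
by rewrite (e _ _ _ _ p) (e _ _ _ _ p') /=; congr pair; ring.
Qed.

(** * The diagonal traced by a ray that hits a vertex *)

Section Diagonal.
Variables (y : R) (b : seq bool).
Hypotheses (y0h : 0 < y < h) (hb : hits alpha (st0 alpha) y b).

Local Notation st := (stat alpha b).

(** Indices are shifted by one: [frm i] is the copy containing the segment from [upt i] to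
    [upt i.+1]. Point 0 is the apex, point [i.+1] the crossing into [stat b i], and point
    [(size b).+2] the vertex hit. *)
Definition frm (i : nat) : frame R :=
  if i is j.+1 then fr (st j) else Frame 0 0 0 true true.

Definition tm (i : nat) : R :=
  if i is j.+1 then if (j <= size b)%N then tau alpha (st j) y
                    else (Wp alpha (st (size b))).1 / c
  else 0.

Definition upt (i : nat) : R * R := (tm i * c, tm i * y).

Lemma ray_stat i : ray alpha (st i) y.
Proof.
case: hb => v _; apply: ray_run => //; [exact: geo0|exact: ray0|exact: valid_take].
Qed.

Lemma frm_refl i : (i <= size b)%N -> frm i.+1 = refl alpha (far (st i)) (frm i).
Proof.
case: i => [|i] ib; first by rewrite /= /stat take0.
by rewrite /= stat_succ //; case: (nth _ _ _).
Qed.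

Lemma perm_stat i : perm3 (lft (st i)) (rgt (st i)) (far (st i)).
Proof. exact: (proj1 (geo_stat alpha b i)). Qed.

Lemma upt_side i : (i <= size b)%N -> exists2 t, 0 < t < 1 &
  upt i.+1 = lerp (Rp alpha (st i)) (Lp alpha (st i)) t.
Proof.
move=> ib; have [t tI [E1 E2]] := tau_coord (ray_stat i).
by exists t => //; rewrite /upt /lerp /tm ib E1 E2.
Qed.

Definition spt (i : nat) : R * R := fold (frm i) (upt i).

(** The crossing point lies on the side shared by two adjacent copies, on which both foldings
    agree. *)
Lemma spt_side i : (i <= size b)%N -> exists2 t, 0 < t < 1 &
  spt i.+1 = lerp (corner (rgt (st i))) (corner (lft (st i))) t /\
  spt i.+1 = fold (frm i) (upt i.+1).
Proof.
move=> ib; have [t tI E] := upt_side ib; exists t => //.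
have p := perm_stat i.
have eL : vtx alpha (frm i.+1) (lft (st i)) = vtx alpha (frm i) (lft (st i)).
  by rewrite frm_refl //; apply: vtx_refl p.
have eR : vtx alpha (frm i.+1) (rgt (st i)) = vtx alpha (frm i) (rgt (st i)).
  by rewrite frm_refl //; apply: vtx_refl (perm3_swap12 p).
have e1 : spt i.+1 = lerp (corner (rgt (st i))) (corner (lft (st i))) t.
  by rewrite /spt E fold_lerp !fold_vtx.
by split=> //; rewrite e1 E fold_lerp /Lp /Rp -/(frm i.+1) eL eR !fold_vtx.
Qed.

Lemma upt_last : upt (size b).+2 = Wp alpha (st (size b)).
Proof.
case: hb => _; rewrite -[X in foldl _ _ X]take_size -/(stat alpha b (size b)).
rewrite /upt /tm ltnn /cr; case: (Wp _ _) => x z /= w0.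
have c0 := lt0r_neq0 (c_gt0 alphaP); congr pair; first by rewrite divfK.
by rewrite mulrAC [x * y]mulrC -(subr0_eq w0) mulrC mulKf.
Qed.

Lemma frm_last : frm (size b).+2 = frm (size b).+1.
Proof. by rewrite /= /stat take_oversize ?take_size. Qed.

Lemma spt_last : spt (size b).+2 = corner (far (st (size b))).
Proof. by rewrite /spt upt_last frm_last fold_vtx. Qed.

Lemma spt_exit i : (i <= (size b).+1)%N -> spt i.+1 = fold (frm i) (upt i.+1).
Proof.
rewrite leq_eqVlt => /orP[/eqP ->|]; first by rewrite /spt frm_last.
by rewrite ltnS => ib; have [t _ []] := spt_side ib.
Qed.

Lemma tm_lt i : (i <= (size b).+1)%N -> tm i < tm i.+1.
Proof.
case: i => [|i] ib; first by exact: (tau_gt0 (ray_stat 0)).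
move: ib; rewrite ltnS => ib; rewrite [tm i.+1]/= ib.
move: ib; rewrite leq_eqVlt => /orP[/eqP E|ib]; last first.
  rewrite /= ib stat_succ //; case: hb => v _.
  by have [] := ray_step alphaP (geo_stat alpha b i) (ray_stat i) (turn_stat ib v).
rewrite E /= ltnn; apply: (hit_tau alphaP (geo_stat alpha b _) (ray_stat _)).
by case: hb => _; rewrite -[X in foldl _ _ X]take_size.
Qed.

Lemma spt_diff i : (i <= (size b).+1)%N ->
  pt (spt i.+1) - pt (spt i) = (tm i.+1 - tm i) *: pt (fold_dir (frm i) (c, y)).
Proof.
move=> ib; rewrite spt_exit // /spt ptN ptD ptZ; congr pt.
by rewrite /fold /fold_dir /upt /=; congr pair; ring.
Qed.

Definition dseq : seq 'rV[R]_2 := mkseq (pt \o spt) (size b).+3.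

Lemma far_lt3 i : (far (st i) < 3)%N.
Proof. by case: (perm_stat i). Qed.

Lemma spt0 : spt 0 = (0, 0).
Proof. by rewrite /spt /fold /fold_dir /upt /=; congr pair; ring. Qed.

Lemma wt_pos l r o t l' r' t' : perm3 l r o -> 0 < t < 1 -> 0 < t' <= 1 ->
  (l' = o /\ r' = r) \/ (l' = l /\ r' = o /\ t' < 1) ->
  forall j, (j < 3)%N -> 0 < wt l r t j + wt l' r' t' j.
Proof.
move=> p /andP[t0 t1] /andP[t0' t1'] [[-> ->]|[-> [-> t2']]] j j3.
  by case: p j3; case: j => [|[|[|]]] // _; rewrite /wt /=; lra.
by case: p j3; case: j => [|[|[|]]] // _; rewrite /wt /=; lra.
Qed.

Lemma dseq_interior i : (i <= (size b).+1)%N ->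
  open_segment (pt (spt i)) (pt (spt i.+1)) `<=` triangle_interior T.
Proof.
have oo (t : R) : 0 < t < 1 -> 0 <= t <= 1 by move=> /andP[? ?]; rewrite !ltW.
have o1 (t : R) : 0 < t < 1 -> 0 < t <= 1 by move=> /andP[-> ?]; rewrite ltW.
case: i => [_|i].
  have [t tI [-> _]] := @spt_side 0 (leq0n _).
  (* The apex is viewed as the end of parameter 1 of the side from vertex 1 to vertex 0. *)
  have -> : spt 0 = lerp (corner 1) (corner 0) 1.
    by rewrite spt0 /lerp /=; congr pair; ring.
  apply: segment_interior Perm012 (perm_stat 0) _ (oo _ tI) _; first by rewrite ler01 lexx.
  have -> : lft (st 0) = 2%N by rewrite /stat take0.
  have -> : rgt (st 0) = 1%N by rewrite /stat take0.
  by case/andP: tI => ? ?; case=> [|[|[|]]] // _; rewrite /wt /=; lra.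
rewrite ltnS => ib; have [t tI [-> _]] := spt_side ib.
have p := perm_stat i.
move: ib; rewrite leq_eqVlt => /orP[/eqP E|ib].
  rewrite E spt_last -E.
  have -> : corner (far (st i)) = lerp (corner (rgt (st i))) (corner (far (st i))) 1.
    by case: (corner (far _)) => a a'; rewrite /lerp /=; congr pair; ring.
  apply: (segment_interior p (perm3_swap13 p) (oo _ tI)); first by rewrite ler01 lexx.
  by apply: (wt_pos p tI); [rewrite ltr01 lexx | left].
have [t' tI' [-> _]] := spt_side ib.
apply: (segment_interior p (perm_stat i.+1) (oo _ tI) (oo _ tI')).
apply: (wt_pos p tI (o1 _ tI')).
rewrite stat_succ //; case: (nth _ _ _); first by left.
by right; split=> //; split=> //; case/andP: tI'.
Qed.

Lemma dseq_diagonal : generalized_diagonal T dseq.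
Proof.
split.
- by rewrite size_mkseq.
- rewrite /= spt0; have -> : pt (0, 0) = tnth T ord0 by rewrite tnth_corner.
  exact: mem_tnth.
- rewrite -nth_last size_mkseq nth_mkseq //= spt_last.
  have -> : pt (corner (far (st (size b)))) = tnth T (Ordinal (far_lt3 (size b))).
    by rewrite tnth_corner.
  exact: mem_tnth.
- move=> i; rewrite size_mkseq => ib.
  rewrite !nth_mkseq //; last by lia.
  by apply: dseq_interior; lia.
- move=> i; rewrite size_mkseq => ib.
  rewrite !nth_mkseq //; try lia.
  exists (side_opp (far (st i))); split.
    have [|t tI [/= -> _]] := @spt_side i; first by lia.
    exact: side_lerp (perm_stat i) tI.
  rewrite /comp !spt_diff; try lia.
  have lt1 : tm i < tm i.+1 by apply: tm_lt; lia.
  have lt2 : tm i.+1 < tm i.+2 by apply: tm_lt; lia.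
  exists ((tm i.+2 - tm i.+1) / (tm i.+1 - tm i)); first by rewrite divr_gt0 ?subr_gt0.
  rewrite mirrorZ mirror_fold_dir ?far_lt3 // scalerA divfK ?subr_eq0 ?gt_eqF //.
  by rewrite frm_refl //; lia.
Qed.

Lemma dseq_length : diagonal_length dseq = (size b).+1.
Proof. by rewrite /diagonal_length size_mkseq subn2. Qed.

Lemma dseq_second : exists2 t, 0 < t & dseq`_1 = pt (t * c, t * y).
Proof.
exists (tm 1); first exact: (tau_gt0 (ray_stat 0)).
have f0 Z : fold (frm 0) Z = Z.
  by case: Z => a z; rewrite /fold /fold_dir /= rotc0 rots0 /sg; congr pair; ring.
by rewrite nth_mkseq // /comp spt_exit // f0.
Qed.

End Diagonal.

Lemma counting_ge_size (U : choiceType) (S : set U) (l : seq U) : uniq l ->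
  (forall x, x \in l -> S x) -> ((size l)%:R%:E <= counting S :> \bar R)%E.
Proof.
move=> ul lS; rewrite /counting; case: asboolP => [fin|_]; last by rewrite leey.
rewrite lee_fin ler_nat; apply: uniq_leq_size ul _ => x xl.
by rewrite in_fset_set // inE; apply: lS.
Qed.

(** Each cut traces a diagonal with [(size b).+1 <= n] reflections, the word [b] being chosen by
    [cid2]. Distinct cuts give distinct diagonals, since the second point determines the slope
    [y / c]. *)
Lemma cuts_complexity n (cuts : seq R) : uniq cuts ->
  (forall y, y \in cuts -> 0 < y < h /\
     exists2 b, (size b < n)%N & hits alpha (st0 alpha) y b) ->
  ((size cuts)%:R%:E <= complexity T n)%E.
Proof.
move=> uc cP.
pose D (y : R) := if pselect (exists2 b, (size b < n)%N & hits alpha (st0 alpha) y b)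
  is left e then dseq y (projT1 (cid2 e)) else [::].
have DP y : y \in cuts -> [/\ generalized_diagonal T (D y),
    (diagonal_length (D y) <= n)%N & exists2 t, 0 < t & (D y)`_1 = pt (t * c, t * y)].
  move=> /cP[yI e]; rewrite /D; case: pselect => // e'.
  case: (cid2 e') => b bn hb /=; rewrite dseq_length.
  by split=> //; [exact: (dseq_diagonal yI hb) | exact: (dseq_second yI hb)].
have <- : size (map D cuts) = size cuts by rewrite size_map.
apply: counting_ge_size.
  rewrite map_inj_in_uniq // => x z /DP[_ _ [t t0 Ex]] /DP[_ _ [t' t0' Ez]] exz.
  have : pt (t * c, t * x) = pt (t' * c, t' * z) by rewrite -Ex -Ez exz.
  case/pt_inj => /(mulIf (lt0r_neq0 (c_gt0 alphaP))) -> /mulfI -> //.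
  exact: lt0r_neq0.
by move=> _ /mapP[x /DP[g l _] ->].
Qed.

End Folding.

(** * The counting dichotomy *)

Lemma abs_sin_le (R : realType) (x : R) : `|sin x| <= `|x|.
Proof.
wlog x0 : x / 0 <= x.
  move=> W; have [|x0] := leP 0 x; first exact: W.
  by rewrite -normrN -[leRHS]normrN -sinN; apply: W; rewrite oppr_ge0 ltW.
have [|z _] := @MVT_segment R sin cos 0 x x0.
  exact/continuous_subspaceT/continuous_sin.
rewrite sin0 !subr0 => ->; rewrite normrM ler_piMl //.
by rewrite ler_norml cos_geN1 cos_le1.
Qed.

Lemma abs_sinDpi (R : realType) (x : R) (z : int) : `|sin (x + z%:~R * pi)| = `|sin x|.
Proof.
have P n (a : R) : `|sin (a + n%:R * pi)| = `|sin a|.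
  elim: n a => [|n IH] a; first by rewrite mul0r addr0.
  by rewrite -natr1 mulrDl mul1r addrA sinDpi normrN.
case: z => n; first exact: P.
by rewrite NegzE mulrNz mulNr -[in RHS](subrK (n.+1%:R * pi) x) P.
Qed.

Section Assembly.
Variables (R : realType) (alpha : R).
Hypothesis alphaP : 0 < alpha < pi / 2.

Local Notation c := (cos alpha).
Local Notation h := (sin alpha).
Local Notation T := (right_triangle alpha).

(** [phi] is the angle of the ray, and [c / cos phi] is the norm of [(c, y)], at most 1. *)
Lemma link_le y : 0 < y < h -> exists phi, forall k,
  `|link alpha y k| <= `|sin ((2 * k%:~R + 1) * alpha - phi)|.
Proof.
move=> /andP[y0 yh]; have c0 := c_gt0 alphaP; have h0 := h_gt0 alphaP.
set phi := atan (y / c); exists phi => k.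
have C0 : 0 < cos phi by rewrite cos_gt0_pihalf // atan_gtNpi2 atan_ltpi2.
have C1 := lt0r_neq0 C0; have c1 := lt0r_neq0 c0.
have tE : sin phi / cos phi = y / c by rewrite -/(tan phi) atanK.
have yE : y = c * sin phi / cos phi by rewrite -mulrA tE mulrCA divff // mulr1.
have -> : link alpha y k = c / cos phi * sin ((2 * k%:~R + 1) * alpha - phi).
  by rewrite /link sinB {1}yE; field.
rewrite normrM ler_piMl // gtr0_norm ?divr_gt0 // ler_pdivrMr // mul1r.
rewrite -(@ler_pXn2r _ 2) ?nnegrE ?(ltW c0) ?(ltW C0) //.
have S : c ^+ 2 * sin phi ^+ 2 = y ^+ 2 * cos phi ^+ 2.
  by rewrite yE -!exprMn divfK.
have := cos2Dsin2 phi; have := cos2Dsin2 alpha.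
have y2 : y ^+ 2 <= h ^+ 2 by rewrite ler_pXn2r ?nnegrE ?(ltW y0) ?(ltW h0) ?(ltW yh).
move=> A B; have D : sin phi ^+ 2 = 1 - cos phi ^+ 2 by lra.
rewrite D in S; have E : h ^+ 2 = 1 - c ^+ 2 by lra.
have P2 := sqr_ge0 (cos phi).
by move: (c ^+ 2) (cos phi ^+ 2) (y ^+ 2) S P2 y2 E A B => a b d *; nra.
Qed.

(** [orbit_approx] with target [(phi - alpha) / pi] gives a hypotenuse within the angle [2 pi / q]
    of the ray modulo [pi], and [pi < 4]. *)
Lemma barrier (q : nat) (p u v : int) y : 0 < y < h -> (0 < q)%N ->
  u * p + v * q%:Z = 1 ->
  `|q%:R * (2 * alpha / pi) - p%:~R| <= q%:R^-1 ->
  forall k0 : int, exists2 i, (i < q)%N &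
    `|link alpha y (k0 + i%:Z)| < 2 * (4 / q%:R).
Proof.
move=> y0h q0 bez app k0; have [phi le] := link_le y0h.
have [i iq [z zP]] := orbit_approx ((phi - alpha) / pi) q0 bez app k0.
exists i => //; apply: le_lt_trans (le _) _.
have p0 := pi_gt0 R; have p1 := lt0r_neq0 p0.
rewrite (_ : _ - phi = ((k0 + i%:Z)%:~R * (2 * alpha / pi) - (phi - alpha) / pi - z%:~R) * pi
   + z%:~R * pi); last by move: p1; move: (pi) => P p1; field.
rewrite abs_sinDpi; apply: le_lt_trans (abs_sin_le _) _.
rewrite normrM (gtr0_norm p0).
apply: le_lt_trans (ler_wpM2r (ltW p0) zP) _.
have q0' : 0 < q%:R^-1 :> R by rewrite invr_gt0 ltr0n.
have := pihalf_lt2 R; rewrite ltr_pdivrMr // => pi4.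
rewrite (_ : 2 * (4 / q%:R) = 2 / q%:R * 4); last by ring.
by rewrite ltr_pM2l ?mulr_gt0 //; lra.
Qed.

(** Past the common prefix, strong induction links [b] and [b'] at [a] through the indices [a - T1],
    [a - T1 - T2] and [a - T2]; the [2m] extra letters keep these at least [i]. *)
Lemma periodic_words_eq (b b' : seq bool) (n i m T1 T2 : nat) :
  size b = n -> size b' = n -> (T1 <= m)%N -> (T2 <= m)%N -> (0 < T1)%N -> (0 < T2)%N ->
  (forall a, (i <= a)%N -> (a + T1 < n)%N -> nth false b a = nth false b (a + T1)) ->
  (forall a, (i <= a)%N -> (a + T2 < n)%N -> nth false b' a = nth false b' (a + T2)) ->
  take (i + m.*2) b = take (i + m.*2) b' -> b = b'.
Proof.
move=> sb sb' t1 t2 p1 p2 P1 P2 tk; apply: (@eq_from_nth _ false); first by rewrite sb.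
rewrite sb; elim/ltn_ind => a IH an.
have [am|am] := ltnP a (i + m.*2).
  by rewrite -(nth_take _ am) tk nth_take.
have s1 : (a - T1 + T1 = a)%N by lia.
have s2 : (a - T2 + T2 = a)%N by lia.
have s3 : (a - T1 - T2 + T2 = a - T1)%N by lia.
have s4 : (a - T1 - T2 + T1 = a - T2)%N by lia.
have e1 := P1 (a - T1)%N; rewrite s1 in e1; rewrite -e1; try lia.
have e2 := P2 (a - T2)%N; rewrite s2 in e2; rewrite -e2; try lia.
rewrite IH; try lia.
have e3 := P2 (a - T1 - T2)%N; rewrite s3 in e3; rewrite -e3; try lia.
rewrite -IH; try lia.
have e4 := P1 (a - T1 - T2)%N; rewrite s4 in e4; rewrite e4; try lia.
by apply: IH; lia.
Qed.

Lemma crD y d Z : cr alpha (y + d) Z = cr alpha y Z - d * Z.1.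
Proof. by rewrite /cr; ring. Qed.

(** [cr y Z] is affine in [y] with slope [- Z.1]; were it too close to 0 at the midpoint, it would
    vanish inside the interval, against [ray]. *)
Lemma margin s lo hi (mid := (lo + hi) / 2) : lo < hi ->
  (forall y, lo < y < hi -> ray alpha s y) ->
  (hi - lo) / 2 * (Lp alpha s).1 <= cr alpha mid (Lp alpha s) /\
  cr alpha mid (Rp alpha s) <= - ((hi - lo) / 2 * (Rp alpha s).1).
Proof.
move=> lh r; have mI : lo < mid < hi by apply/andP; split; rewrite /mid; lra.
have [l0 r0 _] := r _ mI; split; rewrite leNgt; apply/negP => lt.
  have x0 : 0 < (Lp alpha s).1.
    by have := lt_trans l0 lt; rewrite pmulr_rgt0 // divr_gt0 // subr_gt0.
  have := r (mid + cr alpha mid (Lp alpha s) / (Lp alpha s).1).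
  case.
    have q0 := divr_gt0 l0 x0.
    have : cr alpha mid (Lp alpha s) / (Lp alpha s).1 < (hi - lo) / 2 by rewrite ltr_pdivrMr.
    by case/andP: mI => ? ? q1; apply/andP; split; rewrite /mid in q1 *; lra.
  by rewrite crD divfK ?gt_eqF // subrr ltxx.
have x0 : 0 < (Rp alpha s).1.
  have : 0 < (hi - lo) / 2 * (Rp alpha s).1 by lra.
  by rewrite pmulr_rgt0 // divr_gt0 // subr_gt0.
have := r (mid + cr alpha mid (Rp alpha s) / (Rp alpha s).1).
case.
  have q0 : cr alpha mid (Rp alpha s) / (Rp alpha s).1 < 0 by rewrite ltr_pdivrMr // mul0r.
  have : - ((hi - lo) / 2) < cr alpha mid (Rp alpha s) / (Rp alpha s).1.
    by rewrite ltr_pdivlMr // mulNr.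
  by case/andP: mI => ? ?; move=> q1; apply/andP; split; rewrite /mid in q0 q1 *; lra.
by move=> _; rewrite crD divfK ?gt_eqF // subrr ltxx.
Qed.

Variable gam : R.
Hypothesis gam0 : 0 < gam.
Hypothesis tau_gam : forall s y b, 0 < y < h -> geo alpha s -> ray alpha s y ->
  valid alpha s y b -> gam * (size b)%:R - 1 <= tau alpha (foldl (step alpha) s b) y.

(** The margin is the half-length [d] times the first coordinate of the vertex, which grows linearly
    by [tau_gam]. *)
Lemma leaf_strip b lo hi (mid := (lo + hi) / 2) (d := (hi - lo) / 2) :
  0 <= lo -> lo < hi -> hi <= h ->
  (forall y, lo < y < hi -> valid alpha (st0 alpha) y b) ->
  forall i, (i <= size b)%N ->
  d * (c * (gam * i%:R - 1) - 1) <= cr alpha mid (Lp alpha (stat alpha b i)) /\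
  cr alpha mid (Rp alpha (stat alpha b i)) <= - (d * (c * (gam * i%:R - 1) - 1)).
Proof.
move=> lo0 lh hih v i ib.
have inh y : lo < y < hi -> 0 < y < h.
  by move=> /andP[y1 y2]; rewrite (le_lt_trans lo0 y1) (lt_le_trans y2 hih).
have r y : lo < y < hi -> ray alpha (stat alpha b i) y.
  move=> yI; apply: ray_run => //; [exact: geo0|exact: ray0 (inh _ yI)|].
  exact: valid_take (v _ yI).
have mI : lo < mid < hi by apply/andP; split; rewrite /mid; lra.
have [mL mR] := margin lh r.
have tg : gam * i%:R - 1 <= tau alpha (stat alpha b i) mid.
  rewrite -{1}(size_takel ib); apply: tau_gam (inh _ mI) (geo0 alpha) (ray0 alphaP (inh _ mI)) _.
  exact: valid_take (v _ mI).
have c0 := c_gt0 alphaP.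
have d0 : 0 <= d by rewrite divr_ge0 // subr_ge0 ltW.
have tg' : c * (gam * i%:R - 1) - 1 <= c * tau alpha (stat alpha b i) mid - 1.
  by rewrite lerB // ler_pM2l.
have g := geo_stat alpha b i.
have eL := le_trans tg' (tau_le_L alphaP g (r _ mI)).
have eR := le_trans tg' (tau_le_R alphaP g (r _ mI)).
split.
  by apply: le_trans mL; rewrite ler_wpM2l.
by apply: le_trans mR _; rewrite lerN2 ler_wpM2l.
Qed.

Lemma c_le1 : c <= 1. Proof. exact: cos_le1. Qed.

(** The last side crossed has length at most 1 and has to span the whole strip. *)
Lemma leaf_length b lo hi : 0 <= lo -> lo < hi -> hi <= h ->
  (forall y, lo < y < hi -> valid alpha (st0 alpha) y b) ->
  4 <= c * gam * (size b)%:R -> (hi - lo) * (c * gam * (size b)%:R) <= 4.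
Proof.
move=> lo0 lh hih v big.
have [mL mR] := leaf_strip lo0 lh hih v (leqnn _).
set mid := (lo + hi) / 2 in mL mR.
have mI : lo < mid < hi by apply/andP; split; rewrite /mid; lra.
have mI' : 0 < mid < h.
  by case/andP: mI => m1 m2; rewrite (le_lt_trans lo0 m1) (lt_le_trans m2 hih).
have := cr_le1 alphaP mI' (side_le1 alphaP (geo_stat alpha b (size b))).
rewrite ler_norml => /andP[_ le1].
have c0 := c_gt0 alphaP; have c1 := c_le1.
have e : c * (gam * (size b)%:R - 1) - 1 = c * gam * (size b)%:R - c - 1 by ring.
rewrite e in mL mR; move: (c * gam * _) big mL mR {e v} => X X4 mL mR.
have d0 : 0 < hi - lo by rewrite subr_gt0.
have : (hi - lo) * (X / 2) <= (hi - lo) * (X - c - 1) by rewrite ler_pM2l //; lra.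
by lra.
Qed.

Lemma leaf_periodic (q D : nat) (p u v : int) b lo hi
    (m := (q.*2.+1 * 108 * q.+1)%N) : (0 < q)%N ->
  u * p + v * q%:Z = 1 ->
  `|q%:R * (2 * alpha / pi) - p%:~R| <= q%:R^-1 ->
  4 <= c * gam * D%:R ->
  0 <= lo -> lo < hi -> hi <= h ->
  (forall y, lo < y < hi -> valid alpha (st0 alpha) y b) ->
  4 / (q ^ 3)%:R <= hi - lo -> (D * q ^ 2 + m <= size b)%N ->
  exists2 t, (0 < t <= m)%N &
    forall a, (D * q ^ 2 + m <= a)%N -> (a + t < size b)%N ->
      nth false b a = nth false b (a + t).
Proof.
move=> q0 bez app Dbig lo0 lh hih vb len mb.
have q0' : 0 < q%:R :> R by rewrite ltr0n.
pose mid := (lo + hi) / 2.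
have mI : lo < mid < hi by apply/andP; split; rewrite /mid; lra.
have mI' : 0 < mid < h.
  by case/andP: mI => m1 m2; rewrite (le_lt_trans lo0 m1) (lt_le_trans m2 hih).
have w0 : 0 < 4 / q%:R :> R by rewrite divr_gt0.
have c0 := c_gt0 alphaP; have c1 := c_le1.
(* After [D q^2] crossings the vertices have first coordinate at least [2 q^2]; times the
   half-length, at least [2 / q^3], this gives [4 / q]. *)
have st : strip alpha mid (4 / q%:R) b (D * q ^ 2).
  move=> i /andP[ii ib]; have [mL mR] := leaf_strip lo0 lh hih vb ib.
  suff le : 4 / q%:R <= (hi - lo) / 2 * (c * (gam * i%:R - 1) - 1).
    by split; [apply: le_trans mL | apply: le_trans mR _; rewrite lerN2].
  have q1 : 1 <= q%:R :> R by rewrite ler1n.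
  have X : 2 * (q ^ 2)%:R <= c * (gam * i%:R - 1) - 1.
    have : 4 * (q ^ 2)%:R <= c * gam * i%:R.
      apply: (@le_trans _ _ (c * gam * D%:R * (q ^ 2)%:R)).
        by rewrite ler_wpM2r.
      by rewrite -mulrA -natrM ler_pM2l ?mulr_gt0 // ler_nat.
    have : 1 <= (q ^ 2)%:R :> R by rewrite ler1n expn_gt0 q0.
    by rewrite mulrBr mulrA mulr1; lra.
  apply: (@le_trans _ _ (2 / (q ^ 3)%:R * (2 * (q ^ 2)%:R))).
    rewrite !natrX (_ : 2 / q%:R ^+ 3 * _ = 4 / q%:R) //.
    by field; rewrite gt_eqF.
  apply: ler_pM; [by rewrite divr_ge0 | by rewrite mulr_ge0 | | exact: X].
  rewrite (_ : 2 / (q ^ 3)%:R = (4 / (q ^ 3)%:R) / 2); last first.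
    by rewrite [RHS]mulrAC; congr (_ * _); lra.
  by rewrite ler_pM2r.
set k0 := lev (fr (stat alpha b (D * q ^ 2))).
(* One barrier at or above the current level and one below it, each within [q], hence at most [2q]
   apart. *)
have [i2 i2q b2] := barrier mI' q0 bez app k0.
have [i1 i1q b1] := barrier mI' q0 bez app (k0 - q%:Z).
apply: (@strip_period _ _ alphaP mid (4 / q%:R) b q q (D * q ^ 2) m _ _ mI' w0 _ st b1 b2) => //.
- by rewrite invf_div ltr_pdivrMr // ltr_pMr //; lra.
- by rewrite -/k0; clearbody k0; move: i1q i2q; clear; lia.
- by clearbody k0; move: i1q i2q; clear; lia.
Qed.

(* Either the leaves of length at least 4 / q^3 carry at most half of the
   initial interval, and then there are many leaves, or there are many long
   leaves, each of which is determined by its prefix of length M. *)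
Lemma dichotomy (q D : nat) (p u v : int) (n : nat)
    (M := (D * q ^ 2 + 3 * (q.*2.+1 * 108 * q.+1))%N) : (0 < q)%N ->
  u * p + v * q%:Z = 1 ->
  `|q%:R * (2 * alpha / pi) - p%:~R| <= q%:R^-1 ->
  4 <= c * gam * D%:R -> (M <= n)%N ->
  (exists2 N, (N%:R%:E <= complexity T n)%E & h / 2 <= N.+1%:R * (4 / (q ^ 3)%:R)) \/
  (exists2 N, (N%:R%:E <= complexity T M)%E & h / 2 * (c * gam * n%:R) <= N.+1%:R * 4).
Proof.
move=> q0 bez app Dbig Mn.
(* [M] is the prefix length of [periodic_words_eq]: periodicity starts at [D q^2 + k], [k] being the
   pigeonhole window, and [2k] more letters are compared. *)
have eM a k : (a + k + k.*2 = a + 3 * k)%N by lia.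
have h0 := h_gt0 alphaP; have c0 := c_gt0 alphaP.
have rI y : 0 < y < h -> ray alpha (st0 alpha) y by exact: ray0.
have [cn [ln [u1 u2 u3 u4 u5 u6 u7]]] :=
  unfolding_tree_exists alphaP n (geo0 alpha) h0 rI.
have [cM [lM [v1 v2 v3 v4 v5 v6 v7]]] :=
  unfolding_tree_exists alphaP M (geo0 alpha) h0 rI.
have Pn := cuts_complexity alphaP u1 u2; have PM := cuts_complexity alphaP v1 v2.
pose lam := 4 / (q ^ 3)%:R : R.
have [small|big] := leP (h / 2) ((size cn).+1%:R * lam).
  by left; exists (size cn).
right; exists (size cM) => //.
pose G := [seq x <- ln | lam <= x.2.2 - x.2.1].
have leG x : x \in G -> x \in ln /\ lam <= x.2.2 - x.2.1.
  by rewrite mem_filter => /andP[].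
have sumG : h / 2 <= \sum_(x <- G) (x.2.2 - x.2.1).
  have : \sum_(x <- ln | ~~ (lam <= x.2.2 - x.2.1)) (x.2.2 - x.2.1) <= (size cn).+1%:R * lam.
    apply: (@le_trans _ _ (\sum_(x <- ln) lam)).
      rewrite big_mkcond /=; apply: ler_sum => x _; case: ifPn; first by rewrite -ltNge => /ltW.
      by rewrite divr_ge0.
    by rewrite big_const_seq count_predT iter_addr_0 u3 mulr_natl.
  move: u6; rewrite subr0 (bigID (fun x => lam <= x.2.2 - x.2.1)) /= -big_filter -/G.
  by move=> e s2; move: big; lra.
have n1 : 4 <= c * gam * n%:R.
  apply: le_trans Dbig _; rewrite ler_pM2l ?mulr_gt0 // ler_nat.
  apply: leq_trans Mn; apply: leq_trans (leq_addr _ _).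
  by rewrite leq_pmulr // expn_gt0 q0.
have lenG : \sum_(x <- G) (x.2.2 - x.2.1) * (c * gam * n%:R) <= (size G)%:R * 4.
  apply: (@le_trans _ _ (\sum_(x <- G) 4)).
    rewrite big_seq [leRHS]big_seq; apply: ler_sum => x /leG[/u5[x1 x2 x3 x4 x5] _].
    have := leaf_length x2 x3 x4 x5; rewrite x1; exact.
  by rewrite big_const_seq count_predT iter_addr_0 mulr_natl.
apply: (@le_trans _ _ ((size G)%:R * 4)).
  apply: le_trans lenG; rewrite -mulr_suml ler_wpM2r //.
  by apply: le_trans n1.
rewrite ler_pM2r // ler_nat -v3 -(size_map fst G) -(size_map (take M)) -(size_map fst lM).
apply: uniq_leq_size.
  rewrite map_inj_in_uniq; last first.
    move=> b1 b2 /mapP[x /leG[/u5[x1 x2 x3 x4 x5] x6] e1].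
    move=> /mapP[z /leG[/u5[z1 z2 z3 z4 z5] z6] e2]; rewrite {}e1 {}e2 => tk.
    have mn : (D * q ^ 2 + q.*2.+1 * 108 * q.+1 <= n)%N.
      by apply: leq_trans Mn; rewrite leq_add2l leq_pmull.
    have [|t1 /andP[t1a t1b] t1P] := leaf_periodic q0 bez app Dbig x2 x3 x4 x5 x6;
      first by rewrite x1.
    have [|t2 /andP[t2a t2b] t2P] := leaf_periodic q0 bez app Dbig z2 z3 z4 z5 z6;
      first by rewrite z1.
    rewrite x1 in t1P; rewrite z1 in t2P.
    apply: periodic_words_eq x1 z1 t1b t2b t1a t2a t1P t2P _.
    by rewrite eM.
  by apply: subseq_uniq u4; apply/map_subseq/filter_subseq.
move=> _ /mapP[_ /mapP[x /leG[/u5[x1 x2 x3 x4 x5] _] ->] ->].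
(* The midpoint of the leaf shows that the prefix of its word is the word of a leaf at depth [M]. *)
have [m1 m2] : x.2.1 < (x.2.1 + x.2.2) / 2 /\ (x.2.1 + x.2.2) / 2 < x.2.2 by split; lra.
apply: (v7 _ ((x.2.1 + x.2.2) / 2)).
- by rewrite (le_lt_trans x2 m1) (lt_le_trans m2 x4).
- by rewrite size_takel // x1.
- by apply/valid_take/x5; rewrite m1 m2.
Qed.

End Assembly.

(** * The lower bound *)

Lemma powR_natX (R : realType) (x : R) (n : nat) (a : R) : 0 <= x ->
  (x ^+ n) `^ a = x `^ (n%:R * a).
Proof. by move=> x0; rewrite -powR_mulrn // -powRrM. Qed.

Lemma window_le (k q : nat) : (0 < q)%N ->
  (3 * (q.*2.+1 * k * q.+1) <= 3 * 3 * k * 2 * q ^ 2)%N.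
Proof.
move=> q0; have -> : (3 * 3 * k * 2 * q ^ 2 = 3 * (3 * q * k * (2 * q)))%N by ring.
by rewrite leq_mul2l leq_mul ?leq_mul2r ?orbT //; lia.
Qed.

Lemma complexity_lower (R : realType) (alpha : R) : 0 < alpha < pi / 2 ->
  (forall q (p : int), (0 < q)%N -> q%:R * (2 * alpha / pi) <> p%:~R) ->
  exists2 K : R, 0 < K & forall Q, exists2 n, (Q < n)%N &
    exists2 N : nat, (N%:R%:E <= complexity (right_triangle alpha) n)%E &
      K * n%:R `^ (6 / 5) <= N%:R.
Proof.
move=> aP irr; have h0 := h_gt0 aP; have c0 := c_gt0 aP.
have [gam gam0 tau_gam] := tau_linear aP.
pose g := cos alpha * gam; have g0 : 0 < g by rewrite mulr_gt0.
pose D := (Num.trunc (4 / g)).+1.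
have Dbig : 4 <= g * D%:R.
  by rewrite mulrC -ler_pdivrMr //; apply/ltW/truncnS_gt.
pose E := (D + 3 * 3 * 108 * 2)%N.
have E0 : 0 < E%:R :> R by rewrite ltr0n /E addSn.
have E1 : 0 < E%:R `^ (6 / 5) :> R by rewrite powR_gt0.
set h := sin alpha in h0.
pose K := Num.min (h / 16) (h * g / 32 / E%:R `^ (6 / 5)).
exists K.
  by rewrite lt_min !divr_gt0 // !mulr_gt0.
move=> Q.
(* These bounds give in turn [Q < M], [E + 1 <= s], and, for each alternative, that passing from
   [N.+1] to [N] loses at most half of the estimate. *)
pose Q0 := (maxn Q.+1 (maxn (E.+1 ^ 2)
  (maxn (Num.trunc (16 / h)).+1 (Num.trunc (32 / (h * g))).+1)))%N.
have [q [p [u [v [Qq q0 bez app]]]]] := dirichlet_bezout irr Q0.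
move: Qq; rewrite !geq_max => /and4P[Q1 Q2 Q3 Q4].
(* With [s] the square root of [q], the depth [q^(5/2)] is [s^5], while [q^2] and [q^3] are [s^4]
   and [s^6]. *)
pose s : R := Num.sqrt q%:R.
have sq : s ^+ 2 = q%:R by rewrite sqr_sqrtr.
have s0 : 0 <= s by exact: sqrtr_ge0.
have s1 : 1 <= s by rewrite -[1]sqrtr1 ler_wsqrtr // ler1n.
have sE : E%:R + 1 <= s.
  rewrite -(@ler_pXn2r _ 2) ?nnegrE ?addr_ge0 // sq natr1 -natrX ler_nat //.
have s2s n : (2 <= n)%N -> q%:R <= s ^+ n.
  by move=> n2; rewrite -sq; apply: ler_weXn2l.
have h16 : 16 <= h * s ^+ 6.
  rewrite mulrC -ler_pdivrMr //; apply: le_trans (s2s 6%N isT).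
  by apply: le_trans (ltW (truncnS_gt _)) _; rewrite ler_nat.
have h32 : 32 <= h * g * s ^+ 5.
  rewrite mulrC -ler_pdivrMr ?mulr_gt0 //; apply: le_trans (s2s 5%N isT).
  by apply: le_trans (ltW (truncnS_gt _)) _; rewrite ler_nat.
pose n := Num.trunc (s ^+ 5).
have /andP[n1 n2] := truncn_itv (exprn_ge0 5 s0); rewrite -/n -natr1 in n1 n2.
pose M := (D * q ^ 2 + 3 * (q.*2.+1 * 108 * q.+1))%N.
have ME : (M <= E * q ^ 2)%N.
  by rewrite /M /E mulnDl leq_add2l window_le.
have q4 : (q ^ 2)%:R = s ^+ 4 :> R by rewrite natrX -sq -exprM.
have En : (E * q ^ 2 <= n)%N.
  rewrite truncn_ge_nat ?exprn_ge0 // natrM q4 [s ^+ 5]exprS ler_wpM2r ?exprn_ge0 //.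
  by lra.
have qM : (q <= M)%N.
  apply: leq_trans (leq_addr _ _); rewrite mulSn; apply: leq_trans (leq_addr _ _).
  by rewrite expnS expn1 leq_pmulr.
have Mn := leq_trans ME En.
have n1' : (Q < n)%N by apply: leq_trans Mn; apply: leq_trans qM.
have [[N NP le]|[N NP le]] := dichotomy aP gam0 tau_gam q0 bez app Dbig Mn.
  exists n => //; exists N => //.
  apply: (@le_trans _ _ (h / 16 * s ^+ 6)).
    apply: ler_pM; rewrite ?powR_ge0 //.
    - by rewrite le_min !divr_ge0 // ?mulr_ge0 // ltW.
    - by rewrite ge_min lexx.
    rewrite (_ : s ^+ 6 = (s ^+ 5) `^ (6 / 5)).
      by apply: ge0_ler_powR; rewrite ?nnegrE ?exprn_ge0 //.
    by rewrite powR_natX // -powR_mulrn //; congr (_ `^ _); field.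
  have q6 : (q ^ 3)%:R = s ^+ 6 :> R by rewrite natrX -sq -exprM.
  move: le; rewrite q6 mulrA ler_pdivlMr ?exprn_gt0 //; last by rewrite (lt_le_trans _ s1).
  by rewrite -/h -[N.+1%:R]natr1; move: (s ^+ 6) h16 => X; lra.
exists M; first exact: leq_trans Q1 qM.
exists N => //.
(* [M] is at most [E s^4], and [(s^4)^(6/5) = s^(24/5) <= s^5]. *)
have MX : M%:R `^ (6 / 5) <= E%:R `^ (6 / 5) * s ^+ 5.
  apply: (@le_trans _ _ ((E%:R * s ^+ 4) `^ (6 / 5))).
    by apply: ge0_ler_powR; rewrite ?nnegrE ?mulr_ge0 ?exprn_ge0 // -q4 -natrM ler_nat.
  rewrite powRM ?exprn_ge0 // ler_wpM2l ?powR_ge0 // powR_natX //.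
  by rewrite -powR_mulrn // ler_powR //; lra.
apply: (@le_trans _ _ (h * g / 32 * s ^+ 5)).
  apply: (@le_trans _ _ (h * g / 32 / E%:R `^ (6 / 5) * (E%:R `^ (6 / 5) * s ^+ 5))).
    apply: ler_pM; rewrite ?powR_ge0 //.
    - by rewrite le_min !divr_ge0 // ?mulr_ge0 // ltW.
    - by rewrite ge_min lexx orbT.
  by rewrite mulrA divfK // gt_eqF.
have s5 : 2 <= s ^+ 5.
  apply: (@le_trans _ _ s); last by rewrite exprS ler_peMr // exprn_ege1.
  have : 1 <= E%:R :> R by rewrite ler1n -(ltr0n R).
  by lra.
have : h * g * (s ^+ 5 / 2) <= h * g * n%:R.
  by rewrite ler_pM2l ?mulr_gt0 //; move: n2; move: (s ^+ 5) s5 => X; lra.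
by move: le h32; rewrite -/g -/h -[N.+1%:R]natr1; clearbody n; move: (s ^+ 5) => X; lra.
Qed.

(** The upper limit is the limit of the suprema of the tails, each of which is at least [K]. *)
Lemma limn_esup_gt0 (R : realType) (u : (\bar R)^nat) (K : R) : 0 < K ->
  (forall Q, exists2 n, (Q < n)%N & (K%:E <= u n)%E) -> (0 < limn_esup u)%E.
Proof.
move=> K0 H; apply: (@lt_le_trans _ _ K%:E); first by rewrite lte_fin.
rewrite limn_esup_lim; apply: lime_ge; first exact: is_cvg_esups.
apply: nearW => m; have [n mn le] := H m.
by apply: le_trans le _; apply: ereal_sup_ubound; exists n => //=; exact: ltnW.
Qed.

Lemma rational_multiples_negligible (R : realType) :
  (@lebesgue_measure R).-negligible (range (fun r : rat => ratr r * (pi / 2) : R)).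
Proof.
have cA : countable (range (fun r : rat => ratr r * (pi / 2) : R)).
  exact: card_le_trans (card_image_le _ _) (countableP _).
apply/negligibleP; last exact: countable_lebesgue_measure0.
by apply: countable_measurable cA => t; exact: measurable_set1.
Qed.

Theorem theorem5 (R : realType) :
  {ae (@lebesgue_measure R), forall alpha : R, 0 < alpha < pi / 2 ->
    forall eps : R, 0 < eps ->
      (0 < limn_esup (fun n : nat =>
         complexity (right_triangle alpha) n
           * ((n%:R `^ (2 / Num.sqrt 3 - eps))^-1)%:E))%E}.
Proof.
(* The exceptional angles are the rational multiples of [pi / 2], a countable set; elsewhere
   [2 alpha / pi] is irrational. *)
apply: negligibleS (rational_multiples_negligible R) => alpha /= bad.
apply: contrapT => notQ; apply: bad => aP eps eps0.
have irr q (p : int) : (0 < q)%N -> q%:R * (2 * alpha / pi) <> p%:~R.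
  move=> q0 e; apply: notQ; exists (p%:~R / q%:R) => //.
  rewrite fmorph_div /= ratr_int ratr_nat -e.
  have q1 : q%:R != 0 :> R by rewrite pnatr_eq0 -lt0n.
  have := lt0r_neq0 (pi_gt0 R); move: (pi) => P P0.
  by field; rewrite P0 q1.
have [K K0 low] := complexity_lower aP irr.
apply: (limn_esup_gt0 K0) => Q; have [n Qn [N NP le]] := low Q.
exists n => //.
have n1 : 1 <= n%:R :> R by rewrite ler1n (leq_ltn_trans _ Qn).
have n0 : 0 < n%:R `^ (2 / Num.sqrt 3 - eps) by rewrite powR_gt0 // (lt_le_trans _ n1).
apply: (@le_trans _ _ (N%:R%:E * ((n%:R `^ (2 / Num.sqrt 3 - eps))^-1)%:E)%E); last first.
  by apply: lee_wpmul2r => //; rewrite lee_fin invr_ge0 ltW.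
rewrite -EFinM lee_fin ler_pdivlMr //; apply: le_trans le.
rewrite ler_pM2l //; apply: ler_powR => //.
have r0 : 0 < Num.sqrt 3 :> R by rewrite sqrtr_gt0.
(* [(5 / 3)^2 = 25 / 9 <= 3], whence [2 / sqrt 3 <= 6 / 5]. *)
have r3 : 5 / 3 <= Num.sqrt 3 :> R.
  rewrite -(@ler_pXn2r _ 2) ?nnegrE ?sqrtr_ge0 // sqr_sqrtr //; lra.
have : 2 / Num.sqrt 3 <= 6 / 5 :> R by rewrite ler_pdivrMr //; lra.
by lra.
Qed.
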